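(* Let $n\geq 2$. For every exponent $q$ with $\frac{2(n+1)}{n-1}<q\leq\infty$, the extension operator $E$ of the truncated paraboloid $P^{n-1}$ is bounded from $L^2(P^{n-1},d\sigma)$ to $L^q(\mathbb{R}^n)$; that is, there is a constant $A=A(n,q)<\infty$ such that $$\|Ef\|_{L^q(\mathbb{R}^n)}\leq A\,\|f\|_{L^2(P^{n-1},\,d\sigma)}\quad\text{for all } f\in L^2(P^{n-1},d\sigma).$$
   Context: Fix $n\geq 2$. The truncated paraboloid is $P^{n-1}=\{(\xi,|\xi|^2)\in\mathbb{R}^n:\ \xi\in[-1,1]^{n-1}\}$, equipped with its surface measure $d\sigma$. The extension operator $E$ is defined on $L^p(P^{n-1},d\sigma)$ by $$Ef(x)=\int_{P^{n-1}}f(\xi)e^{2\pi i x\cdot\xi}\,d\sigma(\xi),\qquad x\in\mathbb{R}^n,$$ where $\xi$ here denotes a point of $P^{n-1}\subset\mathbb{R}^n$. *)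

(* Defs.v *)
From HB Require Import structures.
From mathcomp Require Import all_boot all_order all_algebra.
From mathcomp Require Import all_classical all_reals all_analysis.
From mathcomp Require Import measurable_realfun complex.
Set Implicit Arguments.
Unset Strict Implicit.
Unset Printing Implicit Defensive.
Import Order.TTheory GRing.Theory Num.Theory.
Import numFieldNormedType.Exports.
Local Open Scope classical_set_scope.
Local Open Scope ring_scope.

(* R^n is [n.-tuple R], with the product of the Borel sigma-algebras of R.
   [measurableTypeR R] is R with the same measurable sets under the display on
   which [lebesgue_measure] is declared. *)

Section LebesgueMeasureRn.
Context {R : realType}.

Definition tuple_cons n (p : measurableTypeR R * n.-tuple R) : n.+1.-tuple R :=
  [tuple of p.1 :: p.2].

Definition tuple_uncons n (t : n.+1.-tuple R) : measurableTypeR R * n.-tuple R :=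
  (thead t, [tuple of behead t]).

Lemma tuple_consK n : cancel (@tuple_cons n) (@tuple_uncons n).
Proof.
move=> [x t]; rewrite /tuple_uncons /tuple_cons/= theadE; congr pair.
exact: val_inj.
Qed.

Lemma measurable_tuple_cons n : measurable_fun [set: measurableTypeR R * n.-tuple R]
  (@tuple_cons n).
Proof. exact: measurable_cons. Qed.

Lemma measurable_tuple_uncons n : measurable_fun [set: n.+1.-tuple R]
  (@tuple_uncons n).
Proof.
apply: measurable_fun_pair; first exact: measurable_tnth.
exact: measurable_behead.
Qed.

(* The image of [lebesgue_measure \x mu] under the bijection R * R^n -> R^(n+1). *)
Definition lebesgue_consm n
    (mu : {sigma_finite_measure set (n.-tuple R) -> \bar R})
    (A : set (n.+1.-tuple R)) : \bar R :=
  (lebesgue_measure \x mu)%E (@tuple_cons n @^-1` A).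

Section lebesgue_consm.
Variables (n : nat) (mu : {sigma_finite_measure set (n.-tuple R) -> \bar R}).

Let mcons A : measurable A -> measurable (@tuple_cons n @^-1` A).
Proof.
by move=> mA; rewrite -[X in measurable X]setTI; exact: measurable_tuple_cons.
Qed.

Let consm0 : lebesgue_consm mu set0 = 0%E.
Proof. by rewrite /lebesgue_consm preimage_set0 measure0. Qed.

Let consm_ge0 A : (0 <= lebesgue_consm mu A)%E.
Proof. exact: measure_ge0. Qed.

Let consm_sigma_additive : semi_sigma_additive (lebesgue_consm mu).
Proof.
move=> F mF tF mUF; rewrite /lebesgue_consm preimage_bigcup.
apply: measure_semi_sigma_additive.
- by move=> i; exact: mcons.
- apply/trivIsetP => /= i j _ _ ij; rewrite -preimage_setI.
  by move/trivIsetP : tF => /(_ _ _ _ _ ij) ->//; rewrite preimage_set0.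
- by rewrite -preimage_bigcup; exact: mcons.
Qed.

HB.instance Definition _ := isMeasure.Build _ _ _ (lebesgue_consm mu)
  consm0 consm_ge0 consm_sigma_additive.

Let consm_sigma_finite : sigma_finite setT (lebesgue_consm mu).
Proof.
have /sigma_finiteP[F [FT ndF Foo]] := sigma_finiteT (@lebesgue_measure R).
have /sigma_finiteP[G [GT ndG Goo]] := sigma_finiteT mu.
exists (fun k => @tuple_uncons n @^-1` (F k `*` G k)).
  rewrite -preimage_bigcup (_ : \bigcup_k _ = setT) ?preimage_setT//.
  apply/seteqP; split=> // -[x y] _.
  have [i _ Fix] : (\bigcup_k F k) x by rewrite -FT.
  have [j _ Gjy] : (\bigcup_k G k) y by rewrite -GT.
  exists (maxn i j) => //; split.
    by move: x Fix; exact/subsetPset/ndF/leq_maxl.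
  by move: y Gjy; exact/subsetPset/ndG/leq_maxr.
move=> k; have [mFk Fkoo] := Foo k; have [mGk Gkoo] := Goo k; split.
  rewrite -[X in measurable X]setTI; apply: measurable_tuple_uncons => //.
  exact: measurableX.
rewrite /lebesgue_consm -comp_preimage (_ : _ \o _ = id) ?preimage_id.
  by rewrite product_measure1E// lte_mul_pinfty// ge0_fin_numE.
by apply/funext => p /=; rewrite tuple_consK.
Qed.

HB.instance Definition _ := Measure_isSigmaFinite.Build _ _ _
  (lebesgue_consm mu) consm_sigma_finite.

End lebesgue_consm.

Fixpoint lebesgue_Rn (n : nat) :
    {sigma_finite_measure set (n.-tuple R) -> \bar R} :=
  match n with
  | 0 => \d_[tuple]
  | m.+1 => lebesgue_consm (lebesgue_Rn m)
  end.

(* This characterizes the Lebesgue measure of R^n among its Borel measures. *)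
Lemma lebesgue_Rn_box n (B : 'I_n -> set R) :
  (forall i, measurable (B i)) ->
  lebesgue_Rn n [set x | forall i, B i (tnth x i)] =
  (\prod_(i < n) lebesgue_measure (B i))%E.
Proof.
elim: n B => [|n IHn] B mB.
  rewrite big_ord0 (_ : mkset _ = setT); first exact: diracT.
  by apply/seteqP; split=> // x _ [].
rewrite big_ord_recl /= /lebesgue_consm.
have mtl : measurable [set x : n.-tuple R | forall i, B (lift ord0 i) (tnth x i)].
  rewrite (_ : mkset _ = \bigcap_(i in [set: 'I_n])
      ((fun x : n.-tuple R => tnth x i) @^-1` B (lift ord0 i))); last first.
    by apply/seteqP; split=> [x h i _|x h i]; exact: h.
  apply: fin_bigcap_measurable => // i _.
  by rewrite -[X in measurable X]setTI; exact: measurable_tnth.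
rewrite (_ : _ @^-1` _ = B ord0 `*`
    [set x : n.-tuple R | forall i, B (lift ord0 i) (tnth x i)]); last first.
  apply/seteqP; split=> [[x t]/= h|[x t]/= [h0 h] i].
    split=> [|i]; first by have := h ord0; rewrite tnth0.
    by have := h (lift ord0 i); rewrite tnthS.
  by case: (unliftP ord0 i) => [j ->|->]; rewrite ?tnthS ?tnth0.
rewrite product_measure1E//; last exact: mB.
congr (_ * _)%E.
exact: IHn.
Qed.

End LebesgueMeasureRn.

Section ComplexValued.
Context {R : realType} {d : measure_display} {T : measurableType d}.
Variable mu : {measure set T -> \bar R}.

Definition cmeasurable_fun (D : set T) (f : T -> R[i]) : Prop :=
  measurable_fun D (fun x => complex.Re (f x)) /\
  measurable_fun D (fun x => complex.Im (f x)).

Definition cintegral (D : set T) (f : T -> R[i]) : R[i] :=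
  (Rintegral mu D (fun x => complex.Re (f x)) +i*
   Rintegral mu D (fun x => complex.Im (f x)))%C.

(* The function is extended by 0 outside of D. *)
Definition cLnorm (D : set T) (p : \bar R) (f : T -> R[i]) : \bar R :=
  Lnorm mu p ((fun x => (Normc.normc (f x))%:E) \_ D).

Definition cLfun (D : set T) (p : \bar R) (f : T -> R[i]) : Prop :=
  cmeasurable_fun D f /\ (cLnorm D p f < +oo)%E.

End ComplexValued.

Section Paraboloid.
Context {R : realType}.

Definition dotp n (x y : n.-tuple R) : R := \sum_(i < n) tnth x i * tnth y i.

Definition sqnorm n (x : n.-tuple R) : R := dotp x x.

(* e^(i t) *)
Definition cexpi (t : R) : R[i] := (cos t +i* sin t)%C.

Definition cube n : set (n.-tuple R) :=
  [set xi | forall i, tnth xi i \in `[-1, 1]].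

(* The point (xi, |xi|^2) of R^n, for xi in R^(n-1): the default value of
   [nth] is read only at the last index. *)
Definition parab_pt n (xi : n.-1.-tuple R) : n.-tuple R :=
  [tuple nth (sqnorm xi) xi i | i < n].

Definition paraboloid n : set (n.-tuple R) := @parab_pt n @` @cube n.-1.

(* The surface measure of the graph of phi(xi) = |xi|^2 over the cube, viewed
   as a measure on R^n, with area element
   sqrt (1 + |grad phi|^2) = sqrt (1 + 4 |xi|^2). *)
Definition surface_measure n (A : set (n.-tuple R)) : \bar R :=
  (\int[lebesgue_Rn n.-1]_(xi in @cube n.-1 `&` @parab_pt n @^-1` A)
    (Num.sqrt (1 + 4 * sqnorm xi))%:E)%E.

Lemma measurable_sqnorm n : measurable_fun [set: n.-tuple R] (@sqnorm n).
Proof.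
apply: measurable_sum => i; apply: measurable_funM; exact: measurable_tnth.
Qed.

Lemma measurable_parab_pt n :
  measurable_fun [set: n.-1.-tuple R] (@parab_pt n).
Proof.
apply/measurable_fun_tnthP => i.
under [X in measurable_fun _ X]eq_fun do rewrite /= tnth_mktuple.
have [lin|lni] := ltnP i n.-1.
  rewrite (_ : (fun _ => _) = (fun x : n.-1.-tuple R => tnth x (Ordinal lin))).
    exact: measurable_tnth.
  by apply/funext => x; rewrite [RHS](tnth_nth (sqnorm x)).
rewrite (_ : (fun _ => _) = @sqnorm n.-1); first exact: measurable_sqnorm.
by apply/funext => x; rewrite nth_default// size_tuple.
Qed.

Lemma measurable_cube n : measurable (@cube n).
Proof.
rewrite (_ : @cube n = \bigcap_(i in [set: 'I_n])
    ((fun x : n.-tuple R => tnth x i) @^-1` `[-1, 1])); last first.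
  by apply/seteqP; split=> [x h i _|x h i]; exact: h.
apply: fin_bigcap_measurable => // i _.
by rewrite -[X in measurable X]setTI; exact: measurable_tnth.
Qed.

Lemma measurable_surface_density n : measurable_fun [set: n.-tuple R]
  (fun xi => (Num.sqrt (1 + 4 * sqnorm xi))%:E).
Proof.
apply/measurable_EFinP.
apply: (measurableT_comp (continuous_measurable_fun (@sqrt_continuous R))).
apply: measurable_funD => //; apply: measurable_funM => //.
exact: measurable_sqnorm.
Qed.

Section surface_measure.
Variable n : nat.
Local Notation sigma := (@surface_measure n).

Let surface0 : sigma set0 = 0%E.
Proof. by rewrite /surface_measure preimage_set0 setI0 integral_set0. Qed.

Let surface_ge0 A : (0 <= sigma A)%E.
Proof. by apply: integral_ge0 => x _; rewrite lee_fin sqrtr_ge0. Qed.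

Let surface_sigma_additive : semi_sigma_additive sigma.
Proof.
have mpre A : measurable A -> measurable (@cube n.-1 `&` @parab_pt n @^-1` A).
  move=> mA; apply: measurableI; first exact: measurable_cube.
  by rewrite -[X in measurable X]setTI; exact: measurable_parab_pt.
move=> F mF tF mUF; rewrite {2}/surface_measure preimage_bigcup setI_bigcupr.
rewrite ge0_integral_bigcup//.
- apply: is_cvg_ereal_nneg_natsum_cond => k _ _; exact: surface_ge0.
- by move=> k; exact: mpre.
- apply: (@measurable_funS _ _ _ _ setT) => //; exact: measurable_surface_density.
- apply/trivIsetP => /= i j _ _ ij; rewrite setIACA -preimage_setI.
  by move/trivIsetP : tF => /(_ _ _ _ _ ij) ->//; rewrite preimage_set0 setI0.
Qed.

HB.instance Definition _ := isMeasure.Build _ _ _ sigma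
  surface0 surface_ge0 surface_sigma_additive.

End surface_measure.

(* Ef(x) is the integral over P^(n-1) of f(xi) e^(2 pi i x.xi) dsigma(xi). *)
Definition extension_op n (f : n.-tuple R -> R[i]) (x : n.-tuple R) : R[i] :=
  cintegral (@surface_measure n) (@paraboloid n)
    (fun xi => f xi * cexpi (2 * pi * dotp x xi)).

End Paraboloid.

(* Main.v *)
Require Import Defs.
From HB Require Import structures.
From mathcomp Require Import all_boot all_order all_algebra.
From mathcomp Require Import all_classical all_reals all_analysis.
From mathcomp Require Import measurable_realfun ess_sup_inf complex ring lra.
Set Implicit Arguments.
Unset Strict Implicit.
Unset Printing Implicit Defensive.
Import Order.TTheory GRing.Theory Num.Theory.
Import numFieldNormedType.Exports.
Local Open Scope classical_set_scope.
Local Open Scope ring_scope.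

(** Write n = d + 1, and split the variable of R^n into y in R^d and the "time"
t, the last coordinate, so that the phase of the kernel is 2 pi (y.xi + t |xi|^2).

No interpolation is needed below L^oo.  Let h be the real or the imaginary part
of +-Ef, let N = ||f||_2, and let G be a bounded part of {h >= lam}.  By duality and
Cauchy-Schwarz, lam^2 |G|^2 <= N^2 S, where S is the squared L^2 norm over the
paraboloid of the Fourier transform of 1_G.  Up to constants S is at most its
analogue weighted by Phi(xi) = prod_i max(0, 4 - xi_i^2), which is the double integral
over times t, t' of a correlation D(t, t') of the slices G_t, G_t'.  It satisfies
- |D(t, t')| <= C (|G_t| + |G_t'|), by a Bessel inequality: the Fourier transform of
  Phi decays like prod_i 1/(1 + y_i^2), which is integrable;
- |D(t, t')| <= C |t - t'|^(-d/2) |G_t| |G_t'|, by van der Corput in each variable.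
Using the first bound when |t - t'| < T and the second one otherwise,
S <= C T |G| + C T^(-d/2) |G|^2, and the choice T ~ (lam/N)^(-4/d) absorbs the
quadratic term: |G| <= C (N/lam)^(2 + 4/d).  This is the weak-type estimate at the
critical exponent 2 + 4/d = 2(n+1)/(n-1); since |Ef| <= C N everywhere, it can be
summed over dyadic levels for every larger q. *)

(** * Dominated real-valued integrals and Fubini's theorem *)

(** The decay $|t-t'|^{-d/2}$ alone cannot close the estimate: for $d \ge 2$ it is not integrable
    across the diagonal. Testing on an indicator removes this obstacle. Near the diagonal,
    $\|1_{G_t}\|_2^2 = |G_t|$ makes the Bessel bound linear in the slices, so the strip $|t-t'|<T$
    contributes only $O(T|G|)$. The second obstacle is the sharp cutoff of the cube, whose Fourier
    transform decays like $1/|y_i|$ in each variable and is not integrable. Since S integrates a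
    nonnegative function, the surface measure may be replaced by a larger weight; the factor
    $4-\xi_i^2$ exceeds 1 on the cube and vanishes at $\pm 2$, which cancels the leading boundary
    terms both in the Bessel and in the van der Corput estimate. Everything is real: a squared
    modulus is a cosine square plus a sine square, and a product $z\bar w$ enters through its real
    part. Treating the four functions $\pm\mathrm{Re}\,Ef$, $\pm\mathrm{Im}\,Ef$ separately makes
    each level set one-sided, so that $1_G$ itself is the dual function. [N] is any positive upper
    bound of the norm, so divisions by it need no case distinction. *)

Section RealIntegrals.
Context d (T : measurableType d) (R : realType) (mu : {measure set T -> \bar R}).
Implicit Types f g : T -> R.

Lemma dominated_integrable f g : measurable_fun setT f ->
  (forall x, `|f x| <= g x) -> mu.-integrable setT (EFin \o g) ->
  mu.-integrable setT (EFin \o f).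
Proof.
move=> mf fg ig; apply: le_integrable ig => //; first exact/measurable_EFinP.
by move=> x _ /=; rewrite lee_fin (le_trans (fg x))// ler_norm.
Qed.

Lemma measurable_of_integrable f : mu.-integrable setT (EFin \o f) ->
  measurable_fun setT f.
Proof. by move/measurable_int => /measurable_EFinP. Qed.

Lemma integrable_scale f k : mu.-integrable setT (EFin \o f) ->
  mu.-integrable setT (EFin \o (fun x => k * f x)).
Proof.
move=> fi; rewrite (_ : _ \o _ = (fun x => k%:E * (EFin \o f) x)%E); last first.
  by apply/funext => x /=; rewrite EFinM.
exact: integrableZl.
Qed.

Lemma integrable_add f g : mu.-integrable setT (EFin \o f) ->
  mu.-integrable setT (EFin \o g) ->
  mu.-integrable setT (EFin \o (fun x => f x + g x)).
Proof.
move=> fi gi; rewrite (_ : _ \o _ = (EFin \o f) \+ (EFin \o g))%E; last first.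
  by apply/funext => x /=; rewrite EFinD.
exact: integrableD.
Qed.

Lemma EFin_Rintegral f : mu.-integrable setT (EFin \o f) ->
  (\int[mu]_x f x)%:E = (\int[mu]_x (f x)%:E)%E.
Proof. by move=> fi; rewrite fineK//; exact: integrable_fin_num. Qed.

Lemma norm_Rintegral_le f g : mu.-integrable setT (EFin \o f) ->
  mu.-integrable setT (EFin \o g) -> (forall x, `|f x| <= g x) ->
  `|\int[mu]_x f x| <= \int[mu]_x g x.
Proof.
move=> fi gi fg; apply: (le_trans (le_normr_Rintegral _ fi)) => //.
apply: le_Rintegral => //; exact: integrable_norm.
Qed.

Lemma integrable_of_le f (c : R) : measurable_fun setT f ->
  (\int[mu]_x `|(f x)%:E| <= c%:E)%E -> mu.-integrable setT (EFin \o f).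
Proof.
move=> mf fc; apply/integrableP; split; first exact/measurable_EFinP.
exact: le_lt_trans fc (ltry _).
Qed.

End RealIntegrals.

Section Fubini.
Context d1 d2 (T1 : measurableType d1) (T2 : measurableType d2) (R : realType).
Variable m1 : {sigma_finite_measure set T1 -> \bar R}.
Variable m2 : {sigma_finite_measure set T2 -> \bar R}.
Variables (p : T1 -> R) (r : T2 -> R).
Hypothesis ip : m1.-integrable setT (EFin \o p).
Hypothesis ir : m2.-integrable setT (EFin \o r).

(** Integrability on a product space is always obtained below by comparison with such a tensor
    product; this is why bounded pieces of level sets, which lie in boxes, are used. *)
Lemma integrable_tensor :
  (m1 \x m2)%E.-integrable setT (EFin \o (fun z => p z.1 * r z.2)).
Proof.
have mp := measurable_of_integrable ip; have mr := measurable_of_integrable ir.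
apply/integrable12ltyP.
  apply/measurable_EFinP/measurable_funM.
    exact: (measurableT_comp mp).
  exact: (measurableT_comp mr).
rewrite (_ : (fun _ => _) =
    (fun x => `|(p x)%:E| * \int[m2]_y `|(r y)%:E|))%E; last first.
  apply/funext => x; rewrite -ge0_integralZl//; last first.
    by apply/measurableT_comp => //; exact/measurable_EFinP.
  by apply: eq_integral => y _ /=; rewrite normrM EFinM.
rewrite ge0_integralZr//.
- apply: lte_mul_pinfty; first exact: integral_ge0.
    rewrite ge0_fin_numE//; last exact: integral_ge0.
    by case/integrableP : ip.
  by case/integrableP : ir.
- by apply/measurableT_comp => //; exact/measurable_EFinP.
- exact: integral_ge0.
Qed.

Variable F : T1 * T2 -> R.
Hypothesis mF : measurable_fun setT F.
Hypothesis Fpr : forall x y, `|F (x, y)| <= p x * r y.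

Lemma integrable_dominated_product :
  (m1 \x m2)%E.-integrable setT (EFin \o F).
Proof.
apply: dominated_integrable integrable_tensor => // -[x y]; exact: Fpr.
Qed.

Lemma integrable_section x : m2.-integrable setT (EFin \o (fun y => F (x, y))).
Proof.
apply: (@dominated_integrable _ _ _ _ _ (fun y => p x * r y)) => //.
- exact: (measurableT_comp mF (measurable_pair1 x)).
- exact: integrable_scale.
Qed.

Let integrable_F := integrable_dominated_product.

Lemma fubini_FE : fubini_F m2 (EFin \o F) = EFin \o (fun x => \int[m2]_y F (x, y)).
Proof.
by apply/funext => x /=; rewrite EFin_Rintegral//; exact: integrable_section.
Qed.

Lemma integrable_Rintegral :
  m1.-integrable setT (EFin \o (fun x => \int[m2]_y F (x, y))).
Proof. by rewrite -fubini_FE; exact: integrable_fubini_F. Qed.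

Lemma Rintegral_iterated :
  \int[m1]_x \int[m2]_y F (x, y) = \int[(m1 \x m2)%E]_z F z.
Proof.
rewrite [RHS]/Rintegral -integral12_prod_meas1//.
by rewrite -[fubini_F _ _]/(fubini_F m2 (EFin \o F)) fubini_FE.
Qed.

End Fubini.

(** Integrability of the sections is not assumed: Tonelli applies to the positive and the negative
    part separately, and [fine] is measurable. *)
Lemma measurable_Rintegral d1 d2 (T1 : measurableType d1) (T2 : measurableType d2)
    (R : realType) (m2 : {sigma_finite_measure set T2 -> \bar R}) (F : T1 * T2 -> R) :
  measurable_fun setT F -> measurable_fun setT (fun x => \int[m2]_y F (x, y)).
Proof.
move=> mF; apply: (measurableT_comp (@fine_measurable R setT measurableT)).
have mF' : measurable_fun setT (EFin \o F) by exact/measurable_EFinP.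
pose Fp x : \bar R := (\int[m2]_y (EFin \o F)^\+ (x, y))%E.
pose Fn x : \bar R := (\int[m2]_y (EFin \o F)^\- (x, y))%E.
rewrite (_ : (fun x => _) = (fun x => Fp x - Fn x)%E); last first.
  apply/funext => x; rewrite integralE; congr (_ - _)%E.
    by apply: eq_integral => y _; rewrite !funeposE.
  by apply: eq_integral => y _; rewrite !funenegE.
apply: emeasurable_funB.
- by apply: measurable_fun_fubini_tonelli_F => //; exact: measurable_funepos.
- by apply: measurable_fun_fubini_tonelli_F => //; exact: measurable_funeneg.
Qed.

Section FubiniSwap.
Context d1 d2 (T1 : measurableType d1) (T2 : measurableType d2) (R : realType).
Variable m1 : {sigma_finite_measure set T1 -> \bar R}.
Variable m2 : {sigma_finite_measure set T2 -> \bar R}.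

Lemma measurable_swapped (F : T1 * T2 -> R) : measurable_fun setT F ->
  measurable_fun setT (fun z : T2 * T1 => F (z.2, z.1)).
Proof.
by move=> mF; apply: (measurableT_comp mF); exact: measurable_fun_pair.
Qed.

Lemma Rintegral_swap (p : T1 -> R) (r : T2 -> R) (F : T1 * T2 -> R) :
  m1.-integrable setT (EFin \o p) -> m2.-integrable setT (EFin \o r) ->
  measurable_fun setT F -> (forall x y, `|F (x, y)| <= p x * r y) ->
  \int[m1]_x \int[m2]_y F (x, y) = \int[m2]_y \int[m1]_x F (x, y).
Proof.
move=> ip ir mF Fpr; rewrite /Rintegral; congr fine.
have := Fubini (integrable_dominated_product ip ir mF Fpr).
have -> : (fun x => \int[m2]_y (EFin \o F) (x, y))%E =
   (fun x => (fine (\int[m2]_y (F (x, y))%:E))%:E)%E.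
  apply/funext => x; rewrite fineK//; apply: integrable_fin_num => //.
  exact: (integrable_section ir mF Fpr).
move=> ->; apply: eq_integral => y _; rewrite fineK//.
apply: integrable_fin_num => //.
apply: (integrable_section ip (measurable_swapped mF)) => y' x /=.
by rewrite [leRHS]mulrC; exact: Fpr.
Qed.

End FubiniSwap.

Section FubiniBilinear.
Context d1 d2 d (T1 : measurableType d1) (T2 : measurableType d2)
  (Y : measurableType d) (R : realType).
Variable m1 : {sigma_finite_measure set T1 -> \bar R}.
Variable m2 : {sigma_finite_measure set T2 -> \bar R}.
Variable nu : {sigma_finite_measure set Y -> \bar R}.
Variables (g1 : T1 -> R) (g2 : T2 -> R) (w : Y -> R).
Hypothesis ig1 : m1.-integrable setT (EFin \o g1).
Hypothesis ig2 : m2.-integrable setT (EFin \o g2).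
Hypothesis iw : nu.-integrable setT (EFin \o w).
Hypothesis w0 : forall y, 0 <= w y.
Variables (u1 v1 : T1 * Y -> R) (u2 v2 : T2 * Y -> R).
Hypotheses (mu1 : measurable_fun setT u1) (mv1 : measurable_fun setT v1).
Hypotheses (mu2 : measurable_fun setT u2) (mv2 : measurable_fun setT v2).
Hypotheses (ug1 : forall x y, `|u1 (x, y)| <= g1 x) (vg1 : forall x y, `|v1 (x, y)|
  <= g1 x).
Hypotheses (ug2 : forall x y, `|u2 (x, y)| <= g2 x) (vg2 : forall x y, `|v2 (x, y)|
  <= g2 x).

Let measurable_integral2 (u : T2 * Y -> R) : measurable_fun setT u ->
  measurable_fun setT (fun y => \int[m2]_x u (x, y)).
Proof. by move=> mu; exact: (measurable_Rintegral m2 (measurable_swapped mu)). Qed.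

Let section1 (u : T1 * Y -> R) y : measurable_fun setT u ->
  (forall x y, `|u (x, y)| <= g1 x) -> m1.-integrable setT (EFin \o (fun x => u (x, y))).
Proof.
move=> mu ug; apply: dominated_integrable ig1 => //.
exact: (measurableT_comp mu (measurable_pair2 y)).
Qed.

Let section2 (u : T2 * Y -> R) y : measurable_fun setT u ->
  (forall x y, `|u (x, y)| <= g2 x) -> m2.-integrable setT (EFin \o (fun x => u (x, y))).
Proof.
move=> mu ug; apply: dominated_integrable ig2 => //.
exact: (measurableT_comp mu (measurable_pair2 y)).
Qed.

(** For complex integrands $u_j + i v_j$, this expands the real part of the weighted integral of
    $U_1\overline{U_2}$. The two outer integrals are exchanged with $\nu$ one after the other:
    during the first exchange the inner integrals [U2], [V2] are frozen as functions bounded by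
    [c2], so no triple product measure is needed. *)
Lemma Rintegral_bilinear :
  \int[nu]_y (w y * ((\int[m1]_x u1 (x, y)) * (\int[m2]_x u2 (x, y)) +
                     (\int[m1]_x v1 (x, y)) * (\int[m2]_x v2 (x, y)))) =
  \int[m1]_x1 \int[m2]_x2 \int[nu]_y
     (w y * (u1 (x1, y) * u2 (x2, y) + v1 (x1, y) * v2 (x2, y))).
Proof.
have mw := measurable_of_integrable iw.
set c2 := \int[m2]_x g2 x.
set U2 := fun y => \int[m2]_x u2 (x, y); set V2 := fun y => \int[m2]_x v2 (x, y).
have U2c y : `|U2 y| <= c2 by apply: norm_Rintegral_le => //; exact: section2.
have V2c y : `|V2 y| <= c2 by apply: norm_Rintegral_le => //; exact: section2.
have mU2 : measurable_fun setT U2 by exact: measurable_integral2.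
have mV2 : measurable_fun setT V2 by exact: measurable_integral2.
pose F (z : Y * T1) := w z.1 * (U2 z.1 * u1 (z.2, z.1) + V2 z.1 * v1 (z.2, z.1)).
have mF : measurable_fun setT F.
  apply: measurable_funM; first exact: (measurableT_comp mw).
  apply: measurable_funD; apply: measurable_funM.
  - exact: (measurableT_comp mU2).
  - exact: measurable_swapped.
  - exact: (measurableT_comp mV2).
  - exact: measurable_swapped.
transitivity (\int[nu]_y \int[m1]_x F (y, x)).
  apply: eq_Rintegral => y _; rewrite /F/=.
  rewrite RintegralZl//; last first.
    by apply: integrable_add; apply: integrable_scale; exact: section1.
  rewrite RintegralD//; try by apply: integrable_scale; exact: section1.
  rewrite !RintegralZl//; try exact: section1.
  by congr (_ * (_ + _)); rewrite mulrC.
rewrite (@Rintegral_swap _ _ _ _ _ nu m1 (fun y => 2 * c2 * w y) g1 F)//; last 2 first.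
  exact: integrable_scale.
  move=> y x; rewrite /F/= normrM ger0_norm//.
  rewrite [leRHS]mulrAC [leRHS]mulrC ler_wpM2l//.
  apply: (le_trans (ler_normD _ _)); rewrite !normrM -mulrA mulr_natl mulr2n.
  by rewrite lerD// ler_pM.
apply: eq_Rintegral => x1 _.
pose H (z : Y * T2) :=
  w z.1 * (u1 (x1, z.1) * u2 (z.2, z.1) + v1 (x1, z.1) * v2 (z.2, z.1)).
transitivity (\int[nu]_y \int[m2]_x H (y, x)).
  apply: eq_Rintegral => y _; rewrite /F /H/=.
  rewrite RintegralZl//; last first.
    by apply: integrable_add; apply: integrable_scale; exact: section2.
  rewrite RintegralD//; try by apply: integrable_scale; exact: section2.
  rewrite !RintegralZl//; try exact: section2.
  by congr (_ * (_ + _)); rewrite mulrC.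
apply: (@Rintegral_swap _ _ _ _ _ nu m2 (fun y => 2 * g1 x1 * w y) g2 H) => //.
- exact: integrable_scale.
- apply: measurable_funM; first exact: (measurableT_comp mw).
  apply: measurable_funD; (apply: measurable_funM; last exact: measurable_swapped).
  + exact: (measurableT_comp (measurableT_comp mu1 (measurable_pair1 x1))).
  + exact: (measurableT_comp (measurableT_comp mv1 (measurable_pair1 x1))).
- move=> y x; rewrite /H/= normrM ger0_norm//.
  rewrite [leRHS]mulrAC [leRHS]mulrC ler_wpM2l//.
  apply: (le_trans (ler_normD _ _)); rewrite !normrM -mulrA mulr_natl mulr2n.
  by rewrite lerD// ler_pM.
Qed.

End FubiniBilinear.

(** When the integral is infinite, [fine] sends it to 0 and the inequality is trivial; hence
    measurability suffices. *)
Lemma norm_Rintegral_le_ereal d (T : measurableType d) (R : realType)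
    (mu : {measure set T -> \bar R}) (f : T -> R) : measurable_fun setT f ->
  (`|\int[mu]_x f x|%:E <= \int[mu]_x `|f x|%:E)%E.
Proof.
move=> mf; have mf' : measurable_fun setT (EFin \o f) by exact/measurable_EFinP.
have h := le_abse_integral mu measurableT mf'.
apply: le_trans _ h; rewrite /Rintegral.
have : (0 <= `|\int[mu]_x (EFin \o f) x|)%E by [].
by case: (\int[mu]_x (EFin \o f) x)%E => [r| |] //=; rewrite normr0.
Qed.

(** * Oscillatory integrals in one variable *)

Section OneDimensional.
Context {R : realType}.
Implicit Types (f g F : R -> R) (a b x s : R).
Notation leb := (@lebesgue_measure R).

Lemma is_derive1_add f g a b x : is_derive x 1 f a -> is_derive x 1 g b ->
  is_derive x 1 (fun y => f y + g y) (a + b).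
Proof. by move=> ? ?; exact: is_deriveD. Qed.

Lemma is_derive1_mul f g a b x : is_derive x 1 f a -> is_derive x 1 g b ->
  is_derive x 1 (fun y => f y * g y) (a * g x + f x * b).
Proof.
move=> fa gb; have h := is_deriveM fa gb; apply: is_derive_eq h _.
by rewrite /GRing.scale/= addrC; congr (_ + _); rewrite mulrC.
Qed.

Lemma is_derive1_inv f a x : f x != 0 -> is_derive x 1 f a ->
  is_derive x 1 (fun y => (f y)^-1) (- a / f x ^+ 2).
Proof.
move=> fx0 fa; have h := is_deriveV fx0 fa; apply: is_derive_eq h _.
by rewrite /GRing.scale/= mulrC mulrN mulNr.
Qed.

Lemma is_derive1_fcomp f g a b x : is_derive x 1 g b -> is_derive (g x) 1 f a ->
  is_derive x 1 (fun y => f (g y)) (a * b).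
Proof. by move=> gb fa; exact: is_derive1_comp. Qed.

Lemma is_derive1_quad a b c x :
  is_derive x 1 (fun y => c + b * y + a * y ^+ 2) (b + 2 * a * x).
Proof.
have xx : is_derive x 1 (fun y : R => y * y) (1 * x + x * 1).
  by exact: is_derive1_mul.
have bx : is_derive x 1 (fun y : R => b * y) (0 * x + b * 1).
  by exact: is_derive1_mul.
have axx : is_derive x 1 (fun y : R => a * (y * y))
    (0 * (x * x) + a * (1 * x + x * 1)).
  by exact: is_derive1_mul.
have := is_derive1_add (is_derive1_add (is_derive_cst c x 1) bx) axx.
by move=> h; apply: is_derive_eq h _; ring.
Qed.

Lemma is_derive_continuous f f' : (forall x, is_derive x 1 f (f' x)) ->
  continuous f.
Proof.
move=> ff' x; apply: differentiable_continuous; apply/derivable1_diffP.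
exact: (@ex_derive _ _ _ _ _ _ _ (ff' x)).
Qed.

Lemma integrable_itv_continuous f a b : continuous f ->
  leb.-integrable `[a, b] (EFin \o f).
Proof.
move=> cf; apply: continuous_compact_integrable; first exact: segment_compact.
exact: continuous_subspaceT.
Qed.

(** Replaces integration by parts: it is enough to exhibit a function whose derivative dominates the
    oscillating integrand and to evaluate it at the endpoints. *)
Lemma Rintegral_le_antiderivative f F F' a b : a < b ->
  continuous f -> continuous F' -> (forall x, is_derive x 1 F (F' x)) ->
  (forall x, a <= x <= b -> f x <= F' x) ->
  \int[leb]_(x in `[a, b]) f x <= F b - F a.
Proof.
move=> ab cf cF' dF fF'.
have cF := is_derive_continuous dF.
apply: (@le_trans _ _ (\int[leb]_(x in `[a, b]) F' x)).
  by apply: le_Rintegral => //; exact: integrable_itv_continuous.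
rewrite /Rintegral (@continuous_FTC2 _ _ F)//=.
- exact: continuous_subspaceT.
- split.
  + move=> x _; exact: (@ex_derive _ _ _ _ _ _ _ (dF x)).
  + by apply: cvg_at_right_filter; exact: cF.
  + by apply: cvg_at_left_filter; exact: cF.
- by move=> x _; rewrite derive1E; apply: (@derive_val _ _ _ _ _ _ _ (dF x)).
Qed.

End OneDimensional.

Section VanDerCorput.
Context {R : realType}.
Implicit Types (a b c x s : R).
Notation leb := (@lebesgue_measure R).

Let quad a b c x := c + b * x + a * x ^+ 2.

Let quad_der a b c x : is_derive x 1 (quad a b c) (b + 2 * a * x).
Proof. exact: is_derive1_quad. Qed.

Let phase s b c x := quad (s ^+ 2) b c x.
Let dphase s b x := b + 2 * s ^+ 2 * x.
Let den s b x := dphase s b x ^+ 2 + s ^+ 2.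
(* [(4 - x^2) sin(phi) phi' / (phi'^2 + s^2)] regularizes the usual primitive
   [sin(phi) / phi'] at the critical point of [phi], so that no case distinction
   on the distance to it is needed; the [atan] term dominates the error. *)
Let prim s b c x := (4 - x ^+ 2) * (sin (phase s b c x) *
   (dphase s b x / den s b x)) + (6 / s * atan (dphase s b x / s) + 2 / s * x).
Let dprim s b c x :=
  (- 2 * x) * (sin (phase s b c x) * (dphase s b x / den s b x)) +
  (4 - x ^+ 2) * (cos (phase s b c x) * dphase s b x * (dphase s b x / den s b x)
   + sin (phase s b c x) * (2 * s ^+ 2 * (s ^+ 2 - dphase s b x ^+ 2) / den s b x ^+ 2))
  + (12 * s ^+ 2 / den s b x + 2 / s).

Let den_gt0 s b x : 0 < s -> 0 < den s b x.
Proof. by move=> s0; rewrite ltr_wpDl ?sqr_ge0// exprn_gt0. Qed.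

Let dphase_der s b x : is_derive x 1 (dphase s b) (2 * s ^+ 2).
Proof.
have h := @is_derive1_quad R 0 (2 * s ^+ 2) b x.
rewrite (_ : dphase s b = (fun y => b + (2 * s ^+ 2) * y + 0 * y ^+ 2)); last first.
  by apply/funext => y; rewrite mul0r addr0.
by apply: is_derive_eq h _; ring.
Qed.

Let prim_der s b c x : 0 < s -> is_derive x 1 (prim s b c) (dprim s b c x).
Proof.
move=> s0; have sN0 : s != 0 by rewrite gt_eqF.
have D0 y : den s b y != 0 by rewrite gt_eqF// den_gt0.
have dD : is_derive x 1 (den s b) (2 * dphase s b x * (2 * s ^+ 2)).
  have h := @is_derive1_add R (fun y => dphase s b y * dphase s b y) _ _ _ x
    (is_derive1_mul (dphase_der s b x) (dphase_der s b x)) (is_derive_cst (s ^+ 2) x 1).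
  rewrite (_ : den s b = (fun y => dphase s b y * dphase s b y + cst (s ^+ 2) y)).
    by apply: is_derive_eq h _; ring.
  by apply/funext => y; rewrite /den expr2.
have dI := is_derive1_inv (D0 x) dD.
have dpD := is_derive1_mul (dphase_der s b x) dI.
have dphi : is_derive x 1 (phase s b c) (dphase s b x) by exact: quad_der.
have dsin := is_derive1_fcomp dphi (is_derive_sin _).
have h1 := is_derive1_mul dsin dpD.
have dm : is_derive x 1 (fun y : R => 4 - y ^+ 2) (- 2 * x).
  have h := @is_derive1_quad R (- 1) 0 4 x.
  rewrite (_ : (fun y : R => 4 - y ^+ 2) = (fun y => 4 + 0 * y + (- 1) * y ^+ 2)).
    by apply: is_derive_eq h _; ring.
  by apply/funext => y; ring.
have h2 := is_derive1_mul dm h1.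
have dps : is_derive x 1 (fun y => dphase s b y / s) (2 * s ^+ 2 / s).
  have h := is_derive1_mul (dphase_der s b x) (is_derive_cst (s^-1) x 1).
  by apply: is_derive_eq h _; rewrite /cst; ring.
have h3 := is_derive1_mul (is_derive_cst (6 / s) x 1) (is_derive1_fcomp dps
  (is_derive1_atan _)).
have h4 := is_derive1_mul (is_derive_cst (2 / s) x 1) (is_derive_id x 1).
have h := is_derive1_add h2 (is_derive1_add h3 h4).
apply: is_derive_eq h _.
rewrite /dprim /cst /=.
have := D0 x; have -> : den s b x = dphase s b x ^+ 2 + s ^+ 2 by [].
set p := dphase s b x; set C := cos _; set S := sin _ => D0x.
move: p C S D0x {dphi dsin h1 h2 h3 h4 dps dpD dI dD} => p C S D0x.
field.
by rewrite sN0.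
Qed.

Let continuous_wcos a b c : continuous (fun x => (4 - x ^+ 2) * cos (quad a b c x)).
Proof.
move=> x; apply: cvgM.
  by apply: cvgB; [exact: cvg_cst|exact: exprn_continuous].
apply: continuous_comp; last exact: continuous_cos.
exact: (is_derive_continuous (quad_der a b c)).
Qed.

Let dprim_continuous s b c : 0 < s -> continuous (dprim s b c).
Proof.
move=> s0 x.
have cphi : {for x, continuous (phase s b c)}.
  exact: (is_derive_continuous (quad_der (s ^+ 2) b c)).
have cp : {for x, continuous (dphase s b)}.
  exact: (is_derive_continuous (dphase_der s b)).
have cp2 : {for x, continuous (fun y => dphase s b y ^+ 2)}.
  exact: (@continuous_comp _ _ _ (dphase s b) (fun z => z ^+ 2) x cp
    (@exprn_continuous _ 2 _)).
have cD : {for x, continuous (den s b)}.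
  by apply: cvgD => //; exact: cvg_cst.
have cVD : {for x, continuous (fun y => (den s b y)^-1)}.
  by apply: cvgV => //; rewrite gt_eqF// den_gt0.
have cVD2 : {for x, continuous (fun y => (den s b y ^+ 2)^-1)}.
  apply: cvgV; first by rewrite expf_neq0// gt_eqF// den_gt0.
  exact: (@continuous_comp _ _ _ (den s b) (fun z => z ^+ 2) x cD (@exprn_continuous
    _ 2 _)).
have cs : {for x, continuous (fun y => sin (phase s b c y))}.
  exact: (@continuous_comp _ _ _ (phase s b c) (@sin R) x cphi (@continuous_sin R _)).
have cc : {for x, continuous (fun y => cos (phase s b c y))}.
  exact: (@continuous_comp _ _ _ (phase s b c) (@cos R) x cphi (@continuous_cos R _)).
have cpD : {for x, continuous (fun y => dphase s b y / den s b y)}.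
  exact: cvgM.
apply: cvgD; first apply: cvgD.
- apply: cvgM; last exact: cvgM.
  by apply: cvgM; [exact: cvg_cst|exact: cvg_id].
- apply: cvgM.
    by apply: cvgB; [exact: cvg_cst|exact: exprn_continuous].
  apply: cvgD; first by apply: cvgM => //; exact: cvgM.
  apply: cvgM => //; apply: cvgM => //.
  apply: cvgM; first exact: cvg_cst.
  by apply: cvgB => //; exact: cvg_cst.
- apply: cvgD; last exact: cvg_cst.
  by apply: cvgM => //; exact: cvg_cst.
Qed.

(** With $p$ = [dphase] and $D = p^2+s^2$, the main term of [dprim] is $(4-x^2)\cos\cdot p^2/D$,
    which misses the integrand by $(4-x^2)\cos\cdot s^2/D$, of size $4s^2/D$. Differentiating $p/D$
    costs $8s^2/D$, and differentiating the weight costs $2/s$. These are exactly compensated by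
    $12s^2/D$, the derivative of the [atan] term, and by $2/s$. *)
Let wcos_le_dprim s b c x : 0 < s -> - 2 <= x <= 2 ->
  (4 - x ^+ 2) * cos (phase s b c x) <= dprim s b c x.
Proof.
move=> s0 /andP[x1 x2]; rewrite /dprim -/(den s b x).
have D0 := den_gt0 b x s0.
have := cos2Dsin2 (phase s b c x).
set C := cos _; set S := sin _; set p := dphase s b x.
have DE : den s b x = p ^+ 2 + s ^+ 2 by [].
move=> CS; set D := den s b x in D0 DE *.
have C1 : `|C| <= 1 by exact: cos_max.
have S1 : `|S| <= 1 by exact: sin_max.
have m4 : `|4 - x ^+ 2| <= 4 by rewrite ler_norml; apply/andP; split; nra.
have DN0 : D != 0 by rewrite gt_eqF.
(* Here $|2x| \le 4$, and $|p|/D \le 1/(2s)$ because $2s|p| \le p^2+s^2$. *)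
have e1 : `|(- 2 * x) * (S * (p / D))| <= 2 / s.
  rewrite normrM -[2 / s]mul1r.
  rewrite (_ : 1 * (2 / s) = 4 * (2 * s)^-1); last first.
    by field; rewrite gt_eqF.
  apply: ler_pM => //; first by rewrite ler_norml; apply/andP; split; lra.
  rewrite normrM -[leRHS]mul1r ler_pM// normrM normfV (gtr0_norm D0).
  rewrite ler_pdivrMr// mulrC ler_pdivlMr ?mulr_gt0//.
  have : 0 <= (`|p| - s) ^+ 2 by exact: sqr_ge0.
  have : `|p| ^+ 2 = p ^+ 2 by rewrite real_normK// num_real.
  by rewrite DE; move=> ? ?; nra.
have e2 : `|(4 - x ^+ 2) * (S * (2 * s ^+ 2 * (s ^+ 2 - p ^+ 2) / D ^+ 2))|
    <= 8 * s ^+ 2 / D.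
  rewrite (_ : 8 * s ^+ 2 / D = 4 * (1 * (2 * s ^+ 2 / D))); last by field.
  rewrite normrM ler_pM// normrM ler_pM//.
  rewrite (_ : _ / _ = (2 * s ^+ 2 / D) * ((s ^+ 2 - p ^+ 2) / D)); last by field.
  have k0 : 0 <= 2 * s ^+ 2 / D by rewrite divr_ge0 ?mulr_ge0 ?sqr_ge0// ltW.
  rewrite normrM ger0_norm// -[leRHS]mulr1 ler_pM//.
  rewrite normrM normfV (gtr0_norm D0) ler_pdivrMr// mul1r DE ler_norml.
  have := sqr_ge0 p; have := sqr_ge0 s.
  by move=> ? ?; apply/andP; split; lra.
have e3 : `|(4 - x ^+ 2) * (C * (s ^+ 2 / D))| <= 4 * s ^+ 2 / D.
  rewrite (_ : 4 * s ^+ 2 / D = 4 * (1 * (s ^+ 2 / D))); last by field.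
  rewrite normrM ler_pM// normrM ler_pM//.
  by rewrite ger0_norm// divr_ge0 ?sqr_ge0// ltW.
have e4 : (4 - x ^+ 2) * C = (4 - x ^+ 2) * (C * p * (p / D))
    + (4 - x ^+ 2) * (C * (s ^+ 2 / D)).
  by rewrite -mulrDr; congr (_ * _); rewrite DE in DN0 *; field.
have e5 : 12 * s ^+ 2 / D = 8 * s ^+ 2 / D + 4 * s ^+ 2 / D by field.
move: e1 e2 e3; rewrite !ler_norml e4 e5 mulrDr.
by move=> /andP[? ?] /andP[? ?] /andP[? ?]; lra.
Qed.

(** The quadratic coefficient is written $s^2$, which makes the van der Corput bound $O(1/s)$ free
    of roots. The oscillating part of [prim] vanishes at $\pm 2$ with the weight; [atan] varies by
    less than $\pi$, which gives $6\pi/s$, and the linear term gives $8/s$. *)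
Lemma vdc_cos_le s b c : 0 < s ->
  \int[leb]_(x in `[- 2, 2]) ((4 - x ^+ 2) * cos (c + b * x + s ^+ 2 * x ^+ 2))
  <= (6 * pi + 8) / s.
Proof.
move=> s0.
apply: (le_trans (Rintegral_le_antiderivative _ (@continuous_wcos (s ^+ 2) b c)
   (@dprim_continuous s b c s0) (fun x => prim_der b c x s0) _)).
- lra.
- by move=> x; exact: wcos_le_dprim.
rewrite /prim.
have -> : (4 - 2 ^+ 2 : R) = 0 by ring.
have -> : (4 - (- 2) ^+ 2 : R) = 0 by ring.
rewrite !mul0r !add0r.
have := atan_ltpi2 (dphase s b 2 / s).
have := atan_gtNpi2 (dphase s b (- 2) / s).
set A := atan _; set B := atan _ => hA hB.
rewrite (_ : _ - _ = (6 * (B - A) + 8) / s); last by field; rewrite gt_eqF.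
by rewrite ler_pM2r ?invr_gt0//; lra.
Qed.

(* Two integrations by parts of [(4 - x^2) cos], multiplied by [1 + b^2]. *)
Let wprim b c x := b * ((4 - x ^+ 2) * sin (quad 0 b c x))
  + (- 2 * x) * cos (quad 0 b c x) + 6 * x.
Let dwprim b c x := b ^+ 2 * ((4 - x ^+ 2) * cos (quad 0 b c x))
  - 2 * cos (quad 0 b c x) + 6.

Let wprim_der b c x : is_derive x 1 (wprim b c) (dwprim b c x).
Proof.
have dm : is_derive x 1 (fun y : R => 4 - y ^+ 2) (- 2 * x).
  have h := @is_derive1_quad R (- 1) 0 4 x.
  rewrite (_ : (fun y : R => 4 - y ^+ 2) = (fun y => 4 + 0 * y + (- 1) * y ^+ 2)).
    by apply: is_derive_eq h _; ring.
  by apply/funext => y; ring.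
have dsin := is_derive1_fcomp (quad_der 0 b c x) (is_derive_sin _).
have dcos := is_derive1_fcomp (quad_der 0 b c x) (is_derive_cos _).
have h1 := is_derive1_mul (is_derive_cst b x 1) (is_derive1_mul dm dsin).
have h2 := is_derive1_mul (is_derive1_mul (is_derive_cst (- 2 : R) x 1) (is_derive_id
  x 1)) dcos.
have h3 := is_derive1_mul (is_derive_cst (6 : R) x 1) (is_derive_id x 1).
have h := is_derive1_add (is_derive1_add h1 h2) h3.
apply: is_derive_eq h _; rewrite /dwprim /cst/=.
by set C := cos _; set S := sin _; ring.
Qed.

Let dwprim_continuous b c : continuous (dwprim b c).
Proof.
move=> x.
have cphi : {for x, continuous (quad 0 b c)}.
  exact: (is_derive_continuous (quad_der 0 b c)).
have cc : {for x, continuous (fun y => cos (quad 0 b c y))}.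
  exact: (@continuous_comp _ _ _ (quad 0 b c) (@cos R) x cphi (@continuous_cos R _)).
apply: cvgD; last exact: cvg_cst.
apply: cvgB.
  by apply: cvgM; [exact: cvg_cst|exact: continuous_wcos].
by apply: cvgM => //; exact: cvg_cst.
Qed.

(** The factor $1+b^2$ instead of $b^2$ covers small frequencies as well. At $\pm 2$ only the cosine
    terms, at most 4 each, and the linear term, 12 each, survive, whence 32. *)
Lemma bump_cos_le b c :
  \int[leb]_(x in `[- 2, 2]) ((4 - x ^+ 2) * cos (c + b * x + 0 * x ^+ 2))
  <= 32 / (1 + b ^+ 2).
Proof.
have b0 : 0 < 1 + b ^+ 2 by rewrite ltr_pwDl// sqr_ge0.
rewrite ler_pdivlMr// mulrC -RintegralZl//; last first.
  exact/integrable_itv_continuous/continuous_wcos.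
apply: (le_trans (@Rintegral_le_antiderivative R _ _ _ _ _ _ _
   (@dwprim_continuous b c) (fun x => wprim_der b c x) _)).
- lra.
- by move=> x; apply: cvgM; [exact: cvg_cst|exact: continuous_wcos].
(* After cancelling the $b^2$ terms the claim is $(M+2)\cos \le 6$ with $M = 4-x^2 \le 4$; this
   fixes the coefficient 6 of the linear term in [wprim]. *)
- move=> x /andP[x1 x2]; rewrite /dwprim -/(quad 0 b c x).
  have := cos_le1 (quad 0 b c x); have := cos_geN1 (quad 0 b c x).
  set C := cos _ => *; rewrite mulrDl mul1r.
  have m0 : 0 <= 4 - x ^+ 2 <= 4 by apply/andP; split; nra.
  by set M := 4 - x ^+ 2 in m0 *; case/andP : m0 => *; nra.
rewrite /wprim.
have -> : (4 - 2 ^+ 2 : R) = 0 by ring.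
have -> : (4 - (- 2) ^+ 2 : R) = 0 by ring.
have := cos_geN1 (quad 0 b c 2); have := cos_geN1 (quad 0 b c (- 2)).
by move=> *; rewrite !mul0r !mulr0 !add0r; lra.
Qed.

End VanDerCorput.

(** * The one-variable weight and squared moduli of oscillatory integrals *)

Section Bump.
Context {R : realType}.
Implicit Types (a b c x : R) (f P : R -> R).
Notation leb := (@lebesgue_measure R).

(* A weight vanishing at the endpoints, so that its Fourier transform is O(b^-2). *)
Definition qbump : R -> R := (fun x => 4 - x ^+ 2) \_ `[- 2, 2].

Lemma qbump_ge0 x : 0 <= qbump x.
Proof.
by rewrite /qbump patchE; case: ifPn => //; rewrite inE/= in_itv/= => /andP[*]; nra.
Qed.

Lemma qbump_ge1 x : x \in `[- 1, 1] -> 1 <= qbump x.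
Proof.
rewrite in_itv/= => /andP[x1 x2]; rewrite /qbump patchE ifT; first by nra.
by rewrite inE/= in_itv/=; apply/andP; split; lra.
Qed.

Lemma qbump_itv f : (fun x => qbump x * f x) = (fun x => (4 - x ^+ 2) * f x) \_ `[- 2, 2].
Proof.
by apply/funext => x; rewrite /qbump !patchE; case: ifP => // _; rewrite mul0r.
Qed.

Let continuous_parabola : continuous (fun x : R => 4 - x ^+ 2).
Proof. by move=> x; apply: cvgB; [exact: cvg_cst|exact: exprn_continuous]. Qed.

Lemma integrable_qbump : leb.-integrable setT (EFin \o qbump).
Proof.
rewrite /qbump -restrict_EFin; apply/integrable_restrict => //; rewrite setTI.
exact: integrable_itv_continuous.
Qed.

Lemma measurable_qbump : measurable_fun setT qbump.
Proof. exact: measurable_of_integrable integrable_qbump. Qed.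

Lemma Rintegral_qbump f :
  \int[leb]_x (qbump x * f x) = \int[leb]_(x in `[- 2, 2]) ((4 - x ^+ 2) * f x).
Proof. by rewrite qbump_itv -Rintegral_mkcond. Qed.

End Bump.

Section TrigSquare.
Context d (T : measurableType d) (R : realType) (mu : {measure set T -> \bar R}).
Implicit Types (w P : T -> R).

(* | \int w e^(i P) dmu |^2; it is multiplicative on product measures. *)
Definition trigsq w P : R :=
  (\int[mu]_x (w x * cos (P x))) ^+ 2 + (\int[mu]_x (w x * sin (P x))) ^+ 2.

Lemma integrable_wcos w P : mu.-integrable setT (EFin \o w) ->
  measurable_fun setT P -> mu.-integrable setT (EFin \o (fun x => w x * cos (P x))).
Proof.
move=> iw mP.
apply: (@dominated_integrable _ _ _ _ _ (fun x => `|w x|)); last first.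
- exact: (integrable_norm iw).
- by move=> x; rewrite normrM ler_piMr// cos_max.
apply: measurable_funM; first exact: measurable_of_integrable iw.
exact: (measurableT_comp (continuous_measurable_fun (@continuous_cos R))).
Qed.

Lemma integrable_wsin w P : mu.-integrable setT (EFin \o w) ->
  measurable_fun setT P -> mu.-integrable setT (EFin \o (fun x => w x * sin (P x))).
Proof.
move=> iw mP.
apply: (@dominated_integrable _ _ _ _ _ (fun x => `|w x|)); last first.
- exact: (integrable_norm iw).
- by move=> x; rewrite normrM ler_piMr// sin_max.
apply: measurable_funM; first exact: measurable_of_integrable iw.
exact: (measurableT_comp (continuous_measurable_fun (@continuous_sin R))).
Qed.

(** A one-sided bound uniform in the phase shift [c] suffices: the shifts $0, \pi, -\pi/2, \pi/2$
    turn the cosine into $\cos$, $-\cos$, $\sin$, $-\sin$. *)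
Lemma trigsq_le w P (M : R) : mu.-integrable setT (EFin \o w) ->
  measurable_fun setT P -> (forall c, \int[mu]_x (w x * cos (c + P x)) <= M) ->
  trigsq w P <= 2 * M ^+ 2.
Proof.
move=> iw mP hM; rewrite /trigsq.
set C := (X in X ^+ 2 + _); set S := (X in _ + X ^+ 2).
have hC : C <= M by have := hM 0; under eq_Rintegral do rewrite add0r.
have hCN : - C <= M.
  have := hM pi; under eq_Rintegral do rewrite addrC cosDpi mulrN -mulN1r.
  by rewrite RintegralZl ?mulN1r//; exact: integrable_wcos.
have hS : S <= M.
  by have := hM (- (pi / 2)); under eq_Rintegral do rewrite addrC cosBpihalf.
have hSN : - S <= M.
  have := hM (pi / 2); under eq_Rintegral do rewrite addrC cosDpihalf mulrN -mulN1r.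
  by rewrite RintegralZl ?mulN1r//; exact: integrable_wsin.
nra.
Qed.

Lemma le_sqrt_trigsq w P : `|\int[mu]_x (w x * cos (P x))| <= Num.sqrt (trigsq w P).
Proof. by rewrite -sqrtr_sqr ler_sqrt ?addr_ge0 ?sqr_ge0// lerDl sqr_ge0. Qed.

End TrigSquare.

Section TrigSquareProduct.
Context d1 d2 (T1 : measurableType d1) (T2 : measurableType d2) (R : realType).
Variable m1 : {sigma_finite_measure set T1 -> \bar R}.
Variable m2 : {sigma_finite_measure set T2 -> \bar R}.
Variables (w1 P1 : T1 -> R) (w2 P2 : T2 -> R).
Hypothesis iw1 : m1.-integrable setT (EFin \o w1).
Hypothesis iw2 : m2.-integrable setT (EFin \o w2).
Hypothesis mP1 : measurable_fun setT P1.
Hypothesis mP2 : measurable_fun setT P2.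

Lemma Rintegral_tensor (f1 : T1 -> R) (f2 : T2 -> R) :
  m1.-integrable setT (EFin \o f1) -> m2.-integrable setT (EFin \o f2) ->
  \int[(m1 \x m2)%E]_z (f1 z.1 * f2 z.2) = (\int[m1]_x f1 x) * (\int[m2]_y f2 y).
Proof.
move=> if1 if2.
have mf1 := measurable_of_integrable if1; have mf2 := measurable_of_integrable if2.
have mF : measurable_fun setT (fun z : T1 * T2 => f1 z.1 * f2 z.2).
  apply: measurable_funM; first exact: (measurableT_comp mf1).
  exact: (measurableT_comp mf2).
rewrite -(Rintegral_iterated (p := fun x => `|f1 x|) (r := fun x => `|f2 x|) _ _ mF).
- by under eq_Rintegral do rewrite /= RintegralZl//; rewrite RintegralZr.
- exact: (integrable_norm if1).
- exact: (integrable_norm if2).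
- by move=> x y; rewrite /= normrM.
Qed.

(** The addition formulas express both components through those of the complex product of the two
    integrals; what remains is $|zw|^2 = |z|^2|w|^2$. A single cosine integral would not factor,
    which is why the squared modulus is carried along. *)
Lemma trigsq_tensor :
  trigsq (m1 \x m2)%E (fun z => w1 z.1 * w2 z.2) (fun z => P1 z.1 + P2 z.2) =
  trigsq m1 w1 P1 * trigsq m2 w2 P2.
Proof.
have ic1 := integrable_wcos iw1 mP1; have is1 := integrable_wsin iw1 mP1.
have ic2 := integrable_wcos iw2 mP2; have is2 := integrable_wsin iw2 mP2.
rewrite /trigsq.
have -> : \int[(m1 \x m2)%E]_z (w1 z.1 * w2 z.2 * cos (P1 z.1 + P2 z.2)) =
  (\int[m1]_x (w1 x * cos (P1 x))) * (\int[m2]_x (w2 x * cos (P2 x))) -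
  (\int[m1]_x (w1 x * sin (P1 x))) * (\int[m2]_x (w2 x * sin (P2 x))).
  rewrite -!Rintegral_tensor// -RintegralB//; last 2 first.
    exact: integrable_tensor ic1 ic2.
    exact: integrable_tensor is1 is2.
  by apply: eq_Rintegral => z _; rewrite cosD; ring.
have -> : \int[(m1 \x m2)%E]_z (w1 z.1 * w2 z.2 * sin (P1 z.1 + P2 z.2)) =
  (\int[m1]_x (w1 x * sin (P1 x))) * (\int[m2]_x (w2 x * cos (P2 x))) +
  (\int[m1]_x (w1 x * cos (P1 x))) * (\int[m2]_x (w2 x * sin (P2 x))).
  rewrite -!Rintegral_tensor// -RintegralD//; last 2 first.
    exact: integrable_tensor is1 ic2.
    exact: integrable_tensor ic1 is2.
  by apply: eq_Rintegral => z _; rewrite sinD; ring.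
ring.
Qed.

End TrigSquareProduct.

Section OneDimensionalBounds.
Context {R : realType}.
Implicit Types (a b c x : R).
Notation leb := (@lebesgue_measure R).

Lemma measurable_quad a b : measurable_fun [set: measurableTypeR R]
  (fun x : measurableTypeR R => b * x + a * x ^+ 2 : R).
Proof.
apply: measurable_funD; first exact: measurable_funM.
by apply: measurable_funM => //; exact: measurable_funX.
Qed.

Let eq_le_Rint (f g : R -> R) : f =1 g ->
  \int[leb]_(x in `[- 2, 2]) f x <= \int[leb]_(x in `[- 2, 2]) g x.
Proof. by move=> fg; rewrite (funext fg). Qed.

Lemma trigsq_qbump_le a b : a != 0 ->
  trigsq leb qbump (fun x => b * x + a * x ^+ 2) <= 2 * (6 * pi + 8) ^+ 2 / `|a|.
Proof.
move=> a0; set s := Num.sqrt `|a|.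
have na0 : 0 < `|a| by rewrite normr_gt0.
have s0 : 0 < s by rewrite sqrtr_gt0.
have s2 : s ^+ 2 = `|a| by rewrite sqr_sqrtr.
rewrite -s2 -mulrA -expr_div_n; apply: trigsq_le.
- exact: integrable_qbump.
- exact: measurable_quad.
move=> c; rewrite Rintegral_qbump.
have [ap|an|] := ltgtP 0 a; last by move=> a0'; rewrite a0' eqxx in a0.
- apply: le_trans (vdc_cos_le b c s0); apply: eq_le_Rint => x.
  by rewrite s2 (gtr0_norm ap) addrA.
- apply: le_trans (vdc_cos_le (- b) (- c) s0); apply: eq_le_Rint => x.
  by rewrite s2 (ltr0_norm an) -cosN; congr (_ * cos _); ring.
Qed.

(** Since $2\cdot 32^2 = 2048 \le 46^2$, the constant 46 turns the bound into a perfect square, so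
    that its square root is rational in [b]. *)
Lemma trigsq_qbump_linear_le b :
  trigsq leb qbump (fun x => b * x + 0 * x ^+ 2) <= (46 / (1 + b ^+ 2)) ^+ 2.
Proof.
apply: (@le_trans _ _ (2 * (32 / (1 + b ^+ 2)) ^+ 2)).
  apply: trigsq_le.
  - exact: integrable_qbump.
  - exact: measurable_quad.
  move=> c; rewrite Rintegral_qbump; apply: le_trans (bump_cos_le b c).
  by apply: eq_le_Rint => x; rewrite addrA.
have : 0 <= ((1 + b ^+ 2)^-1) ^+ 2 by exact: sqr_ge0.
by rewrite !expr_div_n; set D := _ ^+ 2 => D0; nra.
Qed.

End OneDimensionalBounds.

(** * Splitting off the first or the last coordinate of R^n *)

Section Coordinates.
Context {R : realType}.
Notation leb := (@lebesgue_measure R).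
Notation RT := (measurableTypeR R).

Lemma integrable_lebesgue_cons d (f : d.+1.-tuple R -> R) :
  measurable_fun setT f ->
  (leb \x lebesgue_Rn d)%E.-integrable setT (EFin \o (fun z => f (tuple_cons z))) ->
  (lebesgue_Rn d.+1).-integrable setT (EFin \o f).
Proof.
move=> mf fi; apply: (@integrable_pushforward _ _ _ _ R _
  (@measurable_tuple_cons R d) (leb \x lebesgue_Rn d)%E setT (EFin \o f)) => //.
exact/measurable_EFinP.
Qed.

Lemma Rintegral_lebesgue_cons d (f : d.+1.-tuple R -> R) :
  measurable_fun setT f ->
  (leb \x lebesgue_Rn d)%E.-integrable setT (EFin \o (fun z => f (tuple_cons z))) ->
  \int[lebesgue_Rn d.+1]_x f x = \int[(leb \x lebesgue_Rn d)%E]_z f (tuple_cons z).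
Proof.
move=> mf fi; rewrite /Rintegral; congr fine.
have := @integral_pushforward _ _ _ _ R _ (@measurable_tuple_cons R d)
  (leb \x lebesgue_Rn d)%E setT (EFin \o f) _ fi measurableT.
by rewrite preimage_setT; apply; exact/measurable_EFinP.
Qed.

Lemma lebesgue_Rn_cons d (A : set (d.+1.-tuple R)) :
  lebesgue_Rn d.+1 A = (leb \x lebesgue_Rn d)%E (@tuple_cons R d @^-1` A).
Proof. by []. Qed.

Definition tuple_rcons d (p : RT * d.-tuple R) : d.+1.-tuple R :=
  [tuple of rcons p.2 p.1].

Lemma tnth_rcons_last d (t : R) (y : d.-tuple R) :
  tnth (tuple_rcons (t, y)) ord_max = t.
Proof. by rewrite (tnth_nth t) /= nth_rcons size_tuple ltnn eqxx. Qed.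

Lemma tnth_rcons_widen d (t : R) (y : d.-tuple R) (i : 'I_d) :
  tnth (tuple_rcons (t, y)) (widen_ord (leqnSn d) i) = tnth y i.
Proof. by rewrite !(tnth_nth t) /= nth_rcons size_tuple ltn_ord. Qed.

Lemma measurable_tuple_rcons d :
  measurable_fun [set: RT * d.-tuple R] (@tuple_rcons d).
Proof.
apply/measurable_fun_tnthP => i.
have [lin|lni] := ltnP i d.
  rewrite [X in measurable_fun _ X](_ : _ =
      (fun z : RT * d.-tuple R => tnth z.2 (Ordinal lin))); last first.
    apply/funext => -[t y] /=; rewrite -(tnth_rcons_widen t y (Ordinal lin)).
    by congr tnth; exact: val_inj.
  exact: (measurableT_comp (measurable_tnth (Ordinal lin))).
rewrite [X in measurable_fun _ X](_ : _ = fst); first exact: measurable_fst.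
apply/funext => -[t y] /=; rewrite -[RHS](tnth_rcons_last t y); congr tnth.
by apply: val_inj => /=; apply/eqP; rewrite eqn_leq lni -ltnS ltn_ord.
Qed.

(** The measure is built by adding first coordinates, whereas time is the last one. By induction:
    split off the first coordinate [x], split the last coordinate [t] off the section, exchange [x]
    and [t] by Tonelli, and reassemble. *)
Lemma lebesgue_Rn_rcons d (A : set (d.+1.-tuple R)) : measurable A ->
  lebesgue_Rn d.+1 A = (leb \x lebesgue_Rn d)%E (@tuple_rcons d @^-1` A).
Proof.
elim: d A => [|d IHd] A mA.
  rewrite lebesgue_Rn_cons; congr (_ _).
  rewrite (_ : @tuple_cons R 0 = @tuple_rcons 0)//.
  by apply/funext => -[t y]; rewrite (tuple0 y); exact: val_inj.
pose B : set ((RT * RT) * d.-tuple R) :=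
  [set z | A (tuple_cons (z.1.1, tuple_rcons (z.1.2, z.2)))].
have mB : measurable B.
  rewrite -[B]setTI; apply: (_ : measurable_fun setT
    (fun z : (RT * RT) * d.-tuple R =>
       tuple_cons (z.1.1, tuple_rcons (z.1.2, z.2)))) => //.
  apply: (measurableT_comp (@measurable_tuple_cons R _)).
  apply: measurable_fun_pair; first exact: (measurableT_comp measurable_fst).
  apply: (measurableT_comp (@measurable_tuple_rcons _)).
  by apply: measurable_fun_pair => //; exact: (measurableT_comp measurable_snd).
pose g (z : RT * RT) : \bar R := lebesgue_Rn d (xsection B z).
have mg : measurable_fun setT g by exact: measurable_fun_xsection.
have mpre (m : nat) (h : RT * m.-tuple R -> m.+1.-tuple R) (C : set _) :
    measurable_fun setT h -> measurable C -> measurable (h @^-1` C).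
  by move=> mh mC; rewrite -[X in measurable X]setTI; exact: mh.
transitivity (\int[leb]_x \int[leb]_t g (x, t))%E.
  apply: eq_integral => x _ /=; rewrite IHd; last first.
    apply: measurable_xsection; apply: mpre => //; exact: measurable_tuple_cons.
  apply: eq_integral => t _ /=; congr (lebesgue_Rn d _).
  by rewrite !xsectionE.
have g0 z : (0 <= g z)%E by exact: measure_ge0.
rewrite (fubini_tonelli g mg g0).
apply: eq_integral => t _ /=.
rewrite lebesgue_Rn_cons.
apply: eq_integral => x _ /=; congr (lebesgue_Rn d _).
have E y : tuple_cons (x, tuple_rcons (t, y)) = tuple_rcons (t, tuple_cons (x, y)).
  exact: val_inj.
by rewrite !xsectionE; apply/seteqP; split => y /=; rewrite /B /= E.
Qed.

Let rcons_measure d : {measure set (d.+1.-tuple R) -> \bar R} :=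
  measure_function_pushforward__canonical__measure_function_Measure
    (leb \x lebesgue_Rn d)%E (@measurable_tuple_rcons d).

Lemma integrable_lebesgue_rcons d (f : d.+1.-tuple R -> R) :
  measurable_fun setT f ->
  (leb \x lebesgue_Rn d)%E.-integrable setT (EFin \o (fun z => f (tuple_rcons z))) ->
  (lebesgue_Rn d.+1).-integrable setT (EFin \o f).
Proof.
move=> mf /integrableP[_ fi]; apply/integrableP; split; first exact/measurable_EFinP.
rewrite (eq_measure_integral (rcons_measure d)); last first.
  by move=> A mA _; exact: lebesgue_Rn_rcons.
rewrite ge0_integral_pushforward//; first exact: measurable_tuple_rcons.
by apply: measurableT_comp => //; exact/measurable_EFinP.
Qed.

Lemma Rintegral_lebesgue_rcons d (f : d.+1.-tuple R -> R) :
  measurable_fun setT f ->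
  (leb \x lebesgue_Rn d)%E.-integrable setT (EFin \o (fun z => f (tuple_rcons z))) ->
  \int[lebesgue_Rn d.+1]_x f x = \int[(leb \x lebesgue_Rn d)%E]_z f (tuple_rcons z).
Proof.
move=> mf fi; rewrite /Rintegral; congr fine.
transitivity (\int[pushforward (leb \x lebesgue_Rn d) (@tuple_rcons d)]_x (f x)%:E)%E.
  apply: (eq_measure_integral (rcons_measure d)) => A mA _.
  exact: lebesgue_Rn_rcons.
rewrite (integral_pushforward (@measurable_tuple_rcons d) (f := EFin \o f))//.
exact/measurable_EFinP.
Qed.

End Coordinates.

(** * The product weight on R^d and the decay of its oscillatory integrals *)

Section Box.
Context {R : realType}.
Notation leb := (@lebesgue_measure R).

Definition wbox d (xi : d.-tuple R) : R := \prod_(i < d) qbump (tnth xi i).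

Definition qphase d (a : R) (b xi : d.-tuple R) : R :=
  \sum_(i < d) (tnth b i * tnth xi i + a * tnth xi i ^+ 2).

Lemma tnth_cons_lift d (x : R) (y : d.-tuple R) i :
  tnth (tuple_cons (x, y)) (lift ord0 i) = tnth y i.
Proof. by rewrite /tuple_cons/= tnthS. Qed.

Lemma wbox_cons d (z : measurableTypeR R * d.-tuple R) :
  wbox (tuple_cons z) = qbump z.1 * wbox z.2.
Proof.
case: z => x y; rewrite /wbox big_ord_recl; congr (qbump _ * _).
by apply: eq_bigr => i _; rewrite tnth_cons_lift.
Qed.

Lemma wbox_ge0 d (xi : d.-tuple R) : 0 <= wbox xi.
Proof. by apply: prodr_ge0 => i _; exact: qbump_ge0. Qed.

Lemma wbox_ge1 d (xi : d.-tuple R) : cube xi -> 1 <= wbox xi.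
Proof. move=> h; apply: (big_ind (fun x => 1 <= x)) => // [x y|i _].
  exact: mulr_ege1.
by apply: qbump_ge1; exact: h. Qed.

Lemma measurable_wbox d : measurable_fun setT (@wbox d).
Proof.
apply: measurable_prod => i _.
exact: (measurableT_comp measurable_qbump (measurable_tnth i)).
Qed.

Lemma measurable_qphase d a (b : d.-tuple R) : measurable_fun setT (qphase a b).
Proof.
apply: measurable_sum => i; apply: measurable_funD.
  by apply: measurable_funM => //; exact: measurable_tnth.
apply: measurable_funM => //; apply: measurable_funX; exact: measurable_tnth.
Qed.

Lemma integrable_wbox d : (lebesgue_Rn d).-integrable setT (EFin \o @wbox d).
Proof.
elim: d => [|d IHd].
  rewrite (_ : _ \o _ = cst 1%:E).
    exact: finite_measure_integrable_cst.
  by apply/funext => x; rewrite /wbox /= big_ord0.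
apply: integrable_lebesgue_cons; first exact: measurable_wbox.
rewrite (_ : (fun z => _) = (fun z => qbump z.1 * wbox z.2)); last first.
  by apply/funext => z; exact: wbox_cons.
exact: integrable_tensor (@integrable_qbump R) IHd.
Qed.

(** Weight and phase both split over the coordinates, so [trigsq_tensor] peels them off one by one.
    In dimension 0 the measure is a Dirac mass and both sides are 1. *)
Lemma trigsq_wbox d a (b : d.-tuple R) :
  trigsq (lebesgue_Rn d) (@wbox d) (qphase a b) =
  \prod_(i < d) trigsq leb qbump (fun x => tnth b i * x + a * x ^+ 2).
Proof.
elim: d b => [|d IHd] b.
  rewrite big_ord0 /trigsq.
  have q0 x : qphase a b x = 0 by rewrite /qphase big_ord0.
  under eq_Rintegral do rewrite q0 cos0 mulr1 /wbox big_ord0.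
  under [X in _ + X ^+ 2]eq_Rintegral do rewrite q0 sin0 mulr0.
  rewrite !Rintegral_cst// mul0r expr0n addr0 mul1r.
  by rewrite [X in fine X](_ : _ = 1%E) ?expr1n//; exact: diracT.
rewrite big_ord_recl.
have [b0 b'] := tupleP b.
under [X in _ = _ * X]eq_bigr do rewrite tnthS.
rewrite tnth0 -IHd -trigsq_tensor; last 4 first.
- exact: integrable_qbump.
- exact: integrable_wbox.
- exact: measurable_quad.
- exact: measurable_qphase.
have E (z : measurableTypeR R * d.-tuple R) :
    qphase a [tuple of b0 :: b'] (tuple_cons z) =
    b0 * z.1 + a * z.1 ^+ 2 + qphase a b' z.2.
  case: z => x y; rewrite /qphase big_ord_recl /= tnth0; congr (_ + _).
  by apply: eq_bigr => i _; rewrite tnth_cons_lift tnthS.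
have mw := @measurable_wbox d.+1; have mq := measurable_qphase a [tuple of b0 :: b'].
have iT := integrable_tensor (@integrable_qbump R) (@integrable_wbox d).
have mQ : measurable_fun setT (fun z : measurableTypeR R * d.-tuple R =>
    b0 * z.1 + a * z.1 ^+ 2 + qphase a b' z.2).
  rewrite -(funext E).
  exact: (measurableT_comp mq (@measurable_tuple_cons R d)).
rewrite /trigsq; congr (_ ^+ 2 + _ ^+ 2).
- rewrite Rintegral_lebesgue_cons.
  + by apply: eq_Rintegral => z _; rewrite wbox_cons E.
  + apply: measurable_funM => //.
    exact: (measurableT_comp (continuous_measurable_fun (@continuous_cos R))).
  + under eq_fun do rewrite wbox_cons E; exact: integrable_wcos.
- rewrite Rintegral_lebesgue_cons.
  + by apply: eq_Rintegral => z _; rewrite wbox_cons E.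
  + apply: measurable_funM => //.
    exact: (measurableT_comp (continuous_measurable_fun (@continuous_sin R))).
  + under eq_fun do rewrite wbox_cons E; exact: integrable_wsin.
Qed.

Lemma trigsq_wbox_decay d a (b : d.-tuple R) : a != 0 ->
  trigsq (lebesgue_Rn d) (@wbox d) (qphase a b) <=
  (2 * (6 * pi + 8) ^+ 2 / `|a|) ^+ d.
Proof.
move=> a0; rewrite trigsq_wbox -[in leRHS](card_ord d) -prodr_const.
apply: ler_prod => i _; rewrite trigsq_qbump_le// andbT.
by rewrite addr_ge0 ?sqr_ge0.
Qed.

Lemma trigsq_wbox_linear d (b : d.-tuple R) :
  trigsq (lebesgue_Rn d) (@wbox d) (qphase 0 b) <=
  (\prod_(i < d) (46 / (1 + tnth b i ^+ 2))) ^+ 2.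
Proof.
rewrite trigsq_wbox -prodrXl; apply: ler_prod => i _.
by rewrite trigsq_qbump_linear_le andbT addr_ge0 ?sqr_ge0.
Qed.

End Box.

(** * Weighted products of oscillatory integrals as bilinear forms *)

Section TrigBilinear.
Context d1 d2 d (T1 : measurableType d1) (T2 : measurableType d2)
  (Y : measurableType d) (R : realType).
Variable m1 : {sigma_finite_measure set T1 -> \bar R}.
Variable m2 : {sigma_finite_measure set T2 -> \bar R}.
Variable nu : {sigma_finite_measure set Y -> \bar R}.
Variables (g1 : T1 -> R) (g2 : T2 -> R) (w : Y -> R).
Variables (P1 : T1 * Y -> R) (P2 : T2 * Y -> R).
Hypothesis ig1 : m1.-integrable setT (EFin \o g1).
Hypothesis ig2 : m2.-integrable setT (EFin \o g2).
Hypothesis iw : nu.-integrable setT (EFin \o w).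
Hypothesis g10 : forall x, 0 <= g1 x.
Hypothesis g20 : forall x, 0 <= g2 x.
Hypothesis w0 : forall y, 0 <= w y.
Hypotheses (mP1 : measurable_fun setT P1) (mP2 : measurable_fun setT P2).

Let measurable_gtrig dd (T : measurableType dd) (g : T -> R) (P : T * Y -> R) (f : R
  -> R) :
  measurable_fun setT g -> measurable_fun setT P -> continuous f ->
  measurable_fun setT (fun z : T * Y => g z.1 * f (P z)).
Proof.
move=> mg mP cf; apply: measurable_funM; first exact: (measurableT_comp mg).
exact: (measurableT_comp (continuous_measurable_fun cf)).
Qed.

(** The $TT^*$ step: $\cos a\cos b+\sin a\sin b=\cos(a-b)$ leaves a kernel which is the cosine
    integral of the weight at the phase difference. *)
Lemma trig_bilinear :
  \int[nu]_y (w y *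
    ((\int[m1]_x (g1 x * cos (P1 (x, y)))) * (\int[m2]_x (g2 x * cos (P2 (x, y)))) +
     (\int[m1]_x (g1 x * sin (P1 (x, y)))) * (\int[m2]_x (g2 x * sin (P2 (x, y)))))) =
  \int[m1]_x1 \int[m2]_x2
    (g1 x1 * (g2 x2 * \int[nu]_y (w y * cos (P1 (x1, y) - P2 (x2, y))))).
Proof.
have mg1 := measurable_of_integrable ig1; have mg2 := measurable_of_integrable ig2.
have b1 dd (T : measurableType dd) (g : T -> R) (P : T * Y -> R) x y :
    0 <= g x -> `|g x * cos (P (x, y))| <= g x.
  by move=> g0; rewrite normrM ger0_norm// ler_piMr// cos_max.
have b2 dd (T : measurableType dd) (g : T -> R) (P : T * Y -> R) x y :
    0 <= g x -> `|g x * sin (P (x, y))| <= g x.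
  by move=> g0; rewrite normrM ger0_norm// ler_piMr// sin_max.
rewrite (@Rintegral_bilinear _ _ _ _ _ _ _ m1 m2 nu g1 g2 w ig1 ig2 iw w0
  (fun z => g1 z.1 * cos (P1 z)) (fun z => g1 z.1 * sin (P1 z))
  (fun z => g2 z.1 * cos (P2 z)) (fun z => g2 z.1 * sin (P2 z)));
  try by [exact: measurable_gtrig mg1 mP1 (@continuous_cos R)|
          exact: measurable_gtrig mg1 mP1 (@continuous_sin R)|
          exact: measurable_gtrig mg2 mP2 (@continuous_cos R)|
          exact: measurable_gtrig mg2 mP2 (@continuous_sin R)|
          move=> x y; exact: b1|move=> x y; exact: b2].
apply: eq_Rintegral => x1 _; apply: eq_Rintegral => x2 _ /=.
rewrite mulrA -RintegralZl//; last first.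
  apply: integrable_wcos => //; apply: measurable_funB.
    exact: (measurableT_comp mP1 (measurable_pair1 x1)).
  exact: (measurableT_comp mP2 (measurable_pair1 x2)).
by apply: eq_Rintegral => y _; rewrite cosB; ring.
Qed.

Let K x1 x2 := \int[nu]_y (w y * cos (P1 (x1, y) - P2 (x2, y))).

Lemma measurable_trig_kernel : measurable_fun setT (fun z : T1 * T2 => K z.1 z.2).
Proof.
have mw := measurable_of_integrable iw.
pose F (z : (T1 * T2) * Y) := w z.2 * cos (P1 (z.1.1, z.2) - P2 (z.1.2, z.2)).
have m11 : measurable_fun setT (fun z : (T1 * T2) * Y => z.1.1).
  exact: (measurableT_comp measurable_fst).
have m12 : measurable_fun setT (fun z : (T1 * T2) * Y => z.1.2).
  exact: (measurableT_comp measurable_snd).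
have mF : measurable_fun setT F.
  apply: measurable_funM; first exact: (measurableT_comp mw).
  apply: (measurableT_comp (continuous_measurable_fun (@continuous_cos R))).
  apply: measurable_funB.
    by apply: (measurableT_comp mP1); exact: measurable_fun_pair.
  by apply: (measurableT_comp mP2); exact: measurable_fun_pair.
exact: (measurable_Rintegral nu mF).
Qed.

(** A Schur-type test: a bound on the kernel integrated against [g2], uniform in the first variable,
    costs only the mass of [g1]. It serves both regimes: with an integrable kernel near the diagonal
    and a small kernel away from it. *)
Lemma norm_trig_bilinear_le (M : R) :
  (forall x1, `|\int[m2]_x2 (g2 x2 * K x1 x2)| <= M) ->
  `|\int[nu]_y (w y *
    ((\int[m1]_x (g1 x * cos (P1 (x, y)))) * (\int[m2]_x (g2 x * cos (P2 (x, y)))) +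
     (\int[m1]_x (g1 x * sin (P1 (x, y)))) * (\int[m2]_x (g2 x * sin (P2 (x, y))))))|
  <= M * \int[m1]_x g1 x.
Proof.
move=> hM; rewrite trig_bilinear.
have mg1 := measurable_of_integrable ig1; have mg2 := measurable_of_integrable ig2.
have mgK : measurable_fun setT (fun z : T1 * T2 => g2 z.2 * K z.1 z.2).
  apply: measurable_funM; first exact: (measurableT_comp mg2).
  exact: measurable_trig_kernel.
have E x1 : \int[m2]_x2 (g1 x1 * (g2 x2 * K x1 x2)) =
    g1 x1 * \int[m2]_x2 (g2 x2 * K x1 x2).
  rewrite RintegralZl//.
  apply: (@dominated_integrable _ _ _ _ _ (fun x2 => (\int[nu]_y w y) * g2 x2)).
  - exact: (measurableT_comp mgK (measurable_pair1 x1)).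
  - move=> x2; rewrite normrM ger0_norm// mulrC ler_wpM2r//.
    apply: norm_Rintegral_le => //.
      apply: integrable_wcos => //; apply: measurable_funB.
        exact: (measurableT_comp mP1 (measurable_pair1 x1)).
      exact: (measurableT_comp mP2 (measurable_pair1 x2)).
    by move=> y; rewrite normrM ger0_norm// ler_piMr// cos_max.
  - exact: integrable_scale.
under eq_Rintegral do rewrite E.
rewrite -RintegralZl//.
have ub x : `|g1 x * \int[m2]_x2 (g2 x2 * K x x2)| <= M * g1 x.
  by rewrite normrM ger0_norm// mulrC ler_wpM2r.
apply: norm_Rintegral_le => //; last exact: integrable_scale.
apply: (dominated_integrable _ ub); last exact: integrable_scale.
apply: measurable_funM => //.
exact: (measurable_Rintegral m2 mgK).
Qed.

End TrigBilinear.

Section CauchyKernel.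
Context {R : realType}.
Notation leb := (@lebesgue_measure R).

Lemma integral_oneDsqr_shift (c : R) :
  (\int[leb]_x ((1 + (x - c) ^+ 2)^-1)%:E = pi%:E)%E.
Proof.
have d1 (x : R) : is_derive x 1 (fun y : R => y - c) 1.
  have h := is_derive1_add (is_derive_id x (1 : R)) (is_derive_cst (- c) x 1).
  by apply: is_derive_eq h _; rewrite addr0.
have d1E : derive1 (fun y : R => y - c) = cst 1.
  by apply/funext => x; rewrite derive1E; exact: (@derive_val _ _ _ _ _ _ _ (d1 x)).
have := @increasing_ge0_integration_by_substitutionT R (fun y => y - c)
  (fun x => (oneDsqr x)^-1).
rewrite d1E => h.
transitivity (\int[leb]_x ((oneDsqr x)^-1)%:E)%E.
  rewrite h.
  - by apply: eq_integral => x _ /=; rewrite mulr1.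
  - by move=> x y xy; rewrite ltrD2r.
  - exact: cst_continuous.
  - exact: is_cvg_cst.
  - exact: is_cvg_cst.
  - by move=> x; exact: (@ex_derive _ _ _ _ _ _ _ (d1 x)).
  - exact: cvg_addrr_Ny.
  - exact: cvg_addrr.
  - exact: continuous_oneDsqrV.
  - by move=> x; rewrite invr_ge0; exact: (le_trans ler01 (oneDsqr_ge1 x)).
rewrite ge0_symfun_integralT.
- by rewrite -set_itvcy integral0y_oneDsqr -EFinM; congr EFin; field.
- by move=> x; rewrite invr_ge0; exact: (le_trans ler01 (oneDsqr_ge1 x)).
- exact: continuous_oneDsqrV.
- by move=> x; rewrite /= /oneDsqr sqrrN.
Qed.

Lemma measurable_cauchy (k c : R) : measurable_fun [set: measurableTypeR R]
  (fun x : measurableTypeR R => k / (1 + (x - c) ^+ 2) : R).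
Proof.
apply: continuous_measurable_fun => x; apply: cvgM; first exact: cvg_cst.
apply: cvgV; first by rewrite gt_eqF// ltr_pwDl// sqr_ge0.
apply: cvgD; first exact: cvg_cst.
apply: (@continuous_comp _ _ _ (fun y : R => y - c) (fun z => z ^+ 2)).
  by apply: cvgB; [exact: cvg_id|exact: cvg_cst].
exact: exprn_continuous.
Qed.

Lemma integrable_cauchy (k c : R) :
  leb.-integrable setT (EFin \o (fun x => k / (1 + (x - c) ^+ 2))).
Proof.
apply: integrable_scale; apply/integrableP; split.
  apply/measurable_EFinP; have := measurable_cauchy 1 c.
  by under eq_fun do rewrite mul1r.
under eq_integral => x _ do rewrite /= ger0_norm ?invr_ge0 ?addr_ge0 ?sqr_ge0//.
by rewrite integral_oneDsqr_shift ltry.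
Qed.

Lemma Rintegral_cauchy (k c : R) :
  \int[leb]_x (k / (1 + (x - c) ^+ 2)) = k * pi.
Proof.
rewrite RintegralZl//; first by rewrite /Rintegral integral_oneDsqr_shift.
by have := integrable_cauchy 1 c; under eq_fun do rewrite /= mul1r.
Qed.

(** The product over the coordinates of the square roots of the bounds of [trigsq_qbump_linear_le],
    at frequency [y - c]. *)
Definition cauchy_ker d (c y : d.-tuple R) : R :=
  \prod_(i < d) (46 / (1 + (tnth y i - tnth c i) ^+ 2)).

Lemma measurable_cauchy_ker d (c : d.-tuple R) : measurable_fun setT (cauchy_ker c).
Proof.
apply: measurable_prod => i _.
exact: (measurableT_comp (measurable_cauchy 46 (tnth c i)) (measurable_tnth i)).
Qed.

Lemma cauchy_kerP d (c : d.-tuple R) :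
  (lebesgue_Rn d).-integrable setT (EFin \o cauchy_ker c) /\
  \int[lebesgue_Rn d]_y cauchy_ker c y = (46 * pi) ^+ d.
Proof.
elim: d c => [|d IHd] c.
  have E : cauchy_ker c = cst 1.
    by apply/funext => x; rewrite /cauchy_ker big_ord0.
  rewrite E; split; first exact: finite_measure_integrable_cst.
  by rewrite Rintegral_cst// mul1r [X in fine X](_ : _ = 1%E)//; exact: diracT.
have [c0 c'] := tupleP c; have [i' e'] := IHd c'.
have E z : cauchy_ker [tuple of c0 :: c'] (tuple_cons z) =
    46 / (1 + (z.1 - c0) ^+ 2) * cauchy_ker c' z.2.
  case: z => x y; rewrite /cauchy_ker big_ord_recl tnth0 /=.
  by congr (_ * _); apply: eq_bigr => i _; rewrite tnthS tnth_cons_lift.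
have iT := integrable_tensor (integrable_cauchy 46 c0) i'.
have mk := measurable_cauchy_ker [tuple of c0 :: c'].
have iE : (leb \x lebesgue_Rn d)%E.-integrable setT
    (EFin \o (fun z => cauchy_ker [tuple of c0 :: c'] (tuple_cons z))).
  by rewrite (funext E).
split; first exact: integrable_lebesgue_cons.
rewrite Rintegral_lebesgue_cons// (funext E).
rewrite (Rintegral_tensor (integrable_cauchy 46 c0) i') e' exprS.
by congr (_ * _); exact: Rintegral_cauchy.
Qed.

End CauchyKernel.

(** * The weighted extension kernel *)

Section Phase.
Context {R : realType}.

Definition phase d (t : R) (y xi : d.-tuple R) : R :=
  2 * pi * (dotp y xi + t * sqnorm xi).

Lemma measurable_dotp dd (T : measurableType dd) d (f g : T -> d.-tuple R) :
  measurable_fun setT f -> measurable_fun setT g ->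
  measurable_fun setT (fun x => dotp (f x) (g x)).
Proof.
move=> mf mg; apply: measurable_sum => i; apply: measurable_funM.
- exact: (measurableT_comp (measurable_tnth i) mf).
- exact: (measurableT_comp (measurable_tnth i) mg).
Qed.

Lemma measurable_phase dd (T : measurableType dd) d (t : T -> R) (f g : T -> d.-tuple R) :
  measurable_fun setT t -> measurable_fun setT f -> measurable_fun setT g ->
  measurable_fun setT (fun x => phase (t x) (f x) (g x)).
Proof.
move=> mt mf mg; apply: measurable_funM => //; apply: measurable_funD.
  exact: measurable_dotp.
by apply: measurable_funM => //; exact: measurable_dotp.
Qed.

Lemma phaseB d (t t' : R) (y y' xi : d.-tuple R) :
  phase t y xi - phase t' y' xi =
  qphase (2 * pi * (t - t')) [tuple 2 * pi * (tnth y i - tnth y' i) | i < d] xi.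
Proof.
rewrite /phase /qphase /sqnorm /dotp -mulrBr !mulr_sumr.
rewrite -!big_split /= -sumrB mulr_sumr.
by apply: eq_bigr => i _; rewrite tnth_mktuple; ring.
Qed.

(** The numerator in [trigsq_qbump_le]; [bessel_cst] below is the integral of [cauchy_ker]. *)
Definition vdc_cst : R := 2 * (6 * pi + 8) ^+ 2.
Definition bessel_cst d : R := (46 * pi) ^+ d.

Lemma vdc_cst_gt0 : 0 < vdc_cst.
Proof. by rewrite /vdc_cst mulr_gt0// exprn_gt0// addr_gt0// mulr_gt0// pi_gt0. Qed.

Lemma bessel_cst_ge0 d : 0 <= bessel_cst d.
Proof. by rewrite exprn_ge0// mulr_ge0// pi_ge0. Qed.

(** Each coordinate contributes at most [vdc_cst / |t - t'|] to the squared modulus. Bounding this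
    by $s^2$ replaces the power $|t-t'|^{-d/2}$ by the integer power $s^d$; the threshold $T$ is
    then [vdc_cst / s ^+ 2]. The factor $2\pi \ge 1$ of the phase is dropped. *)
Lemma kernel_far d (s t t' : R) (y y' : d.-tuple R) : 0 < s ->
  vdc_cst / s ^+ 2 <= `|t - t'| ->
  `|\int[lebesgue_Rn d]_xi (wbox xi * cos (phase t y xi - phase t' y' xi))| <= s ^+ d.
Proof.
move=> s0 tt'.
have c0 := vdc_cst_gt0.
have tt0 : 0 < `|t - t'| by apply: lt_le_trans tt'; rewrite divr_gt0 ?exprn_gt0.
have pi1 : 1 <= 2 * pi :> R by have := @pi_ge2 R; lra.
under eq_Rintegral do rewrite phaseB.
apply: (le_trans (le_sqrt_trigsq _ _ _)).
rewrite -[leRHS](ger0_norm (exprn_ge0 d (ltW s0))) -sqrtr_sqr ler_sqrt ?sqr_ge0//.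
apply: (le_trans (trigsq_wbox_decay _ _)).
  rewrite mulf_neq0//; last by rewrite -normr_gt0.
  by rewrite gt_eqF// (lt_le_trans ltr01 pi1).
have p0 : 0 < 2 * pi * `|t - t'| by rewrite mulr_gt0// (lt_le_trans ltr01 pi1).
have -> : `|2 * pi * (t - t')| = 2 * pi * `|t - t'|.
  by rewrite normrM ger0_norm// (le_trans ler01 pi1).
have h : vdc_cst / (2 * pi * `|t - t'|) <= s ^+ 2.
  rewrite ler_pdivrMr//.
  move: tt'; rewrite ler_pdivrMr ?exprn_gt0// => /le_trans; apply.
  by rewrite [leRHS]mulrC ler_wpM2r ?sqr_ge0// ler_peMl// ltW.
rewrite -/vdc_cst -exprM mulnC exprM lerXn2r ?nnegrE ?sqr_ge0//.
by rewrite divr_ge0 ?ltW.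
Qed.

(** At equal times the quadratic phases cancel, leaving the Fourier transform of the weight at
    $2\pi(y-y')$, where $2\pi \ge 1$ only improves the decay. *)
Lemma kernel_near d (t : R) (y y' : d.-tuple R) :
  `|\int[lebesgue_Rn d]_xi (wbox xi * cos (phase t y xi - phase t y' xi))|
  <= cauchy_ker y y'.
Proof.
under eq_Rintegral do rewrite phaseB subrr mulr0.
apply: (le_trans (le_sqrt_trigsq _ _ _)).
have q0 x : 0 < 1 + x ^+ 2 :> R by rewrite ltr_pwDl// sqr_ge0.
have k0 : 0 <= cauchy_ker y y'.
  by apply: prodr_ge0 => i _; rewrite divr_ge0// ltW.
rewrite -[leRHS](ger0_norm k0) -sqrtr_sqr ler_sqrt ?sqr_ge0//.
apply: (le_trans (trigsq_wbox_linear _)).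
rewrite lerXn2r ?nnegrE//; first by apply: prodr_ge0 => i _; rewrite divr_ge0// ltW.
apply: ler_prod => i _; rewrite divr_ge0 ?(ltW (q0 _))//= tnth_mktuple.
rewrite ler_pM2l// lef_pV2 ?posrE// lerD2l exprMn.
have -> : (tnth y' i - tnth y i) ^+ 2 = (tnth y i - tnth y' i) ^+ 2 by ring.
rewrite ler_peMl ?sqr_ge0// exprn_ege1//.
by have := @pi_ge2 R; lra.
Qed.

End Phase.

Section Bessel.
Context {R : realType} (d : nat).
Notation lebd := (@lebesgue_Rn R d).
Variables (t : R) (g : d.-tuple R -> R).
Hypothesis g01 : forall y, 0 <= g y <= 1.
Hypothesis ig : lebd.-integrable setT (EFin \o g).

(** Schur's test with the kernel [cauchy_ker]: one factor [g] is bounded by 1, so the kernel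
    contributes its integral, and the other factor gives the mass. *)
Lemma bessel_wbox :
  \int[lebd]_xi (wbox xi *
    ((\int[lebd]_y (g y * cos (phase t y xi))) * (\int[lebd]_y (g y * cos (phase t y
      xi))) +
     (\int[lebd]_y (g y * sin (phase t y xi))) * (\int[lebd]_y (g y * sin (phase t y
       xi)))))
  <= bessel_cst d * \int[lebd]_y g y.
Proof.
have g0 y : 0 <= g y by case/andP: (g01 y).
pose P (z : d.-tuple R * d.-tuple R) := phase t z.1 z.2.
have mP : measurable_fun setT P by exact: measurable_phase.
have iw := @integrable_wbox R d; have mg := measurable_of_integrable ig.
apply: (le_trans (ler_norm _)).
apply: (norm_trig_bilinear_le ig ig iw g0 g0 (@wbox_ge0 _ d) mP mP) => y.
have [iK IK] := cauchy_kerP y.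
rewrite /bessel_cst -IK; apply: norm_Rintegral_le => //.
- apply: (@dominated_integrable _ _ _ _ _ (cauchy_ker y)) => //.
  + apply: measurable_funM => //.
    exact: (measurableT_comp (measurable_trig_kernel iw mP mP) (measurable_pair1 y)).
  + move=> y'; rewrite normrM ger0_norm//.
    case/andP: (g01 y') => _ g1.
    by rewrite (le_trans _ (kernel_near t y y'))// ler_piMl.
- move=> y'; rewrite normrM ger0_norm//.
  case/andP: (g01 y') => _ g1.
  by rewrite (le_trans _ (kernel_near t y y'))// ler_piMl.
Qed.

End Bessel.

(** * The local restriction estimate, sliced by time *)

Section TimeSlices.
Context {R : realType} (d : nat).
Notation leb := (@lebesgue_measure R).
Notation RT := (measurableTypeR R).
Notation lebd := (@lebesgue_Rn R d).
Variables (g : RT * d.-tuple R -> R) (p : RT -> R) (r : d.-tuple R -> R).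
Hypothesis mg : measurable_fun setT g.
Hypothesis g01 : forall z, 0 <= g z <= 1.
Hypothesis ip : leb.-integrable setT (EFin \o p).
Hypothesis ir : lebd.-integrable setT (EFin \o r).
Hypothesis gpr : forall t y, `|g (t, y)| <= p t * r y.

Let g0 z : 0 <= g z. Proof. by case/andP : (g01 z). Qed.

Let ig t : lebd.-integrable setT (EFin \o (fun y => g (t, y))).
Proof. exact: (integrable_section ir mg gpr). Qed.

Let mass t := \int[lebd]_y g (t, y).

Let mass_ge0 t : 0 <= mass t.
Proof. by apply: Rintegral_ge0 => y _. Qed.

Let imass : leb.-integrable setT (EFin \o mass).
Proof. exact: (integrable_Rintegral ip ir mg gpr). Qed.

Let total := \int[(leb \x lebd)%E]_z g z.

Let totalE : total = \int[leb]_t mass t.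
Proof. by rewrite /mass (Rintegral_iterated ip ir mg gpr). Qed.

(* For [f = cos, sin]: the Fourier transform of the time slice of [g]. *)
Let u (f : R -> R) (z : RT * d.-tuple R) :=
  \int[lebd]_y (g (z.1, y) * f (phase z.1 y z.2)).

Let measurable_u f : continuous f -> measurable_fun setT (u f).
Proof.
move=> cf.
pose F (z : (RT * d.-tuple R) * d.-tuple R) :=
  g (z.1.1, z.2) * f (phase z.1.1 z.2 z.1.2).
have m11 : measurable_fun setT (fun z : (RT * d.-tuple R) * d.-tuple R => z.1.1).
  exact: (measurableT_comp measurable_fst).
have m12 : measurable_fun setT (fun z : (RT * d.-tuple R) * d.-tuple R => z.1.2).
  exact: (measurableT_comp measurable_snd).
have mF : measurable_fun setT F.
  apply: measurable_funM.
    by apply: (measurableT_comp mg); exact: measurable_fun_pair.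
  apply: (measurableT_comp (continuous_measurable_fun cf)).
  exact: measurable_phase.
exact: (measurable_Rintegral lebd mF).
Qed.

Let u_le f t xi : (forall x, `|f x| <= 1) -> continuous f -> `|u f (t, xi)| <= mass t.
Proof.
move=> f1 cf.
have fg y : `|g (t, y) * f (phase t y xi)| <= g (t, y).
  by rewrite normrM ger0_norm// ler_piMr.
apply: norm_Rintegral_le => //.
apply: dominated_integrable fg _ => //.
apply: measurable_funM; first exact: (measurable_of_integrable (ig t)).
apply: (measurableT_comp (continuous_measurable_fun cf)).
exact: measurable_phase.
Qed.

Let cm := @cos_max R. Let sm := @sin_max R.
Let cc := @continuous_cos R. Let cs := @continuous_sin R.

Let corr (z : RT * RT) := \int[lebd]_xi (wbox xi *
  (u cos (z.1, xi) * u cos (z.2, xi) + u sin (z.1, xi) * u sin (z.2, xi))).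

Let measurable_corr : measurable_fun setT corr.
Proof.
pose F (z : (RT * RT) * d.-tuple R) := wbox z.2 *
  (u cos (z.1.1, z.2) * u cos (z.1.2, z.2) + u sin (z.1.1, z.2) * u sin (z.1.2, z.2)).
have m11 : measurable_fun setT (fun z : (RT * RT) * d.-tuple R => z.1.1).
  exact: (measurableT_comp measurable_fst).
have m12 : measurable_fun setT (fun z : (RT * RT) * d.-tuple R => z.1.2).
  exact: (measurableT_comp measurable_snd).
have mF : measurable_fun setT F.
  apply: measurable_funM; first exact: (measurableT_comp (@measurable_wbox _ _)).
  apply: measurable_funD; apply: measurable_funM.
  - by apply: (measurableT_comp (measurable_u cc)); exact: measurable_fun_pair.
  - by apply: (measurableT_comp (measurable_u cc)); exact: measurable_fun_pair.
  - by apply: (measurableT_comp (measurable_u cs)); exact: measurable_fun_pair.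
  - by apply: (measurableT_comp (measurable_u cs)); exact: measurable_fun_pair.
exact: (measurable_Rintegral lebd mF).
Qed.

Let uu_le f t t' xi : (forall x, `|f x| <= 1) -> continuous f ->
  `|u f (t, xi) * u f (t', xi)| <= mass t * mass t'.
Proof. by move=> f1 cf; rewrite normrM ler_pM// u_le. Qed.

Let integrable_corr t t' : lebd.-integrable setT (EFin \o (fun xi => wbox xi *
  (u cos (t, xi) * u cos (t', xi) + u sin (t, xi) * u sin (t', xi)))).
Proof.
apply: (@dominated_integrable _ _ _ _ _ (fun xi => (mass t * mass t' + mass t * mass
  t') * wbox xi)).
- apply: measurable_funM; first exact: measurable_wbox.
  have m1 f s : continuous f -> measurable_fun setT (fun xi => u f (s, xi)).
    by move=> cf; exact: (measurableT_comp (measurable_u cf) (measurable_pair1 s)).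
  by apply: measurable_funD; apply: measurable_funM; apply: m1.
- move=> xi; rewrite normrM ger0_norm ?wbox_ge0// mulrC ler_wpM2r ?wbox_ge0//.
  by rewrite (le_trans (ler_normD _ _))// lerD// uu_le.
- apply: integrable_scale; exact: integrable_wbox.
Qed.

(** Since the weight is nonnegative, $|aa'+bb'| \le (a^2+b^2+a'^2+b'^2)/2$ under the integral
    reduces the claim to the diagonal values [corr (t, t)] and [corr (t', t')], which the Bessel
    inequality bounds. *)
Let corr_near t t' :
  `|corr (t, t')| <= bessel_cst d / 2 * (mass t + mass t').
Proof.
have b s : corr (s, s) <= bessel_cst d * mass s.
  exact: (bessel_wbox s (fun y => g01 (s, y)) (ig s)).
apply: (@le_trans _ _ (2^-1 * (corr (t, t) + corr (t', t')))); last first.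
  have := b t; have := b t'.
  by move: (corr (t, t)) (corr (t', t')) (bessel_cst d) (mass t) (mass t') => *; lra.
rewrite /corr -RintegralD// -RintegralZl//; last exact: integrable_add.
apply: norm_Rintegral_le => //.
  by apply: integrable_scale; exact: integrable_add.
move=> xi /=; rewrite normrM ger0_norm ?wbox_ge0//.
set a := u cos (t, xi); set b1 := u sin (t, xi).
set a' := u cos (t', xi); set b' := u sin (t', xi).
rewrite -mulrDr mulrCA ler_wpM2l ?wbox_ge0// ler_norml.
have := sqr_ge0 (a - a'); have := sqr_ge0 (b1 - b').
have := sqr_ge0 (a + a'); have := sqr_ge0 (b1 + b').
by move=> *; apply/andP; split; nra.
Qed.

Let corr_far s t t' : 0 < s -> vdc_cst / s ^+ 2 <= `|t - t'| ->
  `|corr (t, t')| <= s ^+ d * mass t * mass t'.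
Proof.
move=> s0 tt'.
pose P t0 (z : d.-tuple R * d.-tuple R) := phase t0 z.1 z.2.
have mP t0 : measurable_fun setT (P t0) by exact: measurable_phase.
rewrite mulrAC.
apply: (norm_trig_bilinear_le (ig t) (ig t') (@integrable_wbox R d)
  (fun y => g0 (t, y)) (fun y => g0 (t', y)) (@wbox_ge0 _ d) (mP t) (mP t')) => y.
have sd : 0 <= s ^+ d by rewrite exprn_ge0// ltW.
rewrite -RintegralZl//.
have b y' : `|g (t', y') * \int[lebd]_xi (wbox xi * cos (P t (y, xi) - P t' (y', xi)))|
    <= s ^+ d * g (t', y').
  by rewrite normrM ger0_norm// mulrC ler_wpM2r// kernel_far.
apply: norm_Rintegral_le => //; last exact: integrable_scale.
apply: (dominated_integrable _ b); last exact: integrable_scale.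
apply: measurable_funM; first exact: (measurable_of_integrable (ig t')).
exact: (measurableT_comp (measurable_trig_kernel (@integrable_wbox R d) (mP t) (mP
  t')) (measurable_pair1 y)).
Qed.

Let near_ind (T : R) (z : RT * RT) : R := (`|z.1 - z.2| < T)%R%:R.

Let measurable_near_ind T : measurable_fun setT (near_ind T).
Proof.
apply: (@measurableT_comp _ _ _ _ _ _ (fun b : bool => b%:R : R)) => //.
apply: measurable_fun_ltr => //.
apply: measurableT_comp => //.
exact: measurable_funB.
Qed.

Let integral_near_ind T t : 0 < T ->
  (\int[leb]_t' (near_ind T (t, t'))%:E = (2 * T)%:E)%E.
Proof.
move=> T0.
transitivity (\int[leb]_t' (\1_(`]t - T, t + T[%classic : set RT) t')%:E)%E.
  apply: eq_integral => t' _; rewrite indicE; congr ((nat_of_bool _)%:R%:E).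
  by rewrite /near_ind/= mem_setE in_itv/= ltr_norml; apply/idP/idP => /andP[? ?];
    apply/andP; split; lra.
rewrite integral_indic// ?setIT ?setTI. rewrite /= lebesgue_measure_itv/= lte_fin
  ifT; last lra.
by rewrite -EFinD; congr EFin; lra.
Qed.

(** For [cos] and [sin]: the components, not yet squared, of the Fourier transform of [g] at the
    point of the paraboloid above [xi]. *)
Let total_sq (f : R -> R) xi := \int[leb]_t u f (t, xi).

Lemma corr_total :
  \int[lebd]_xi (wbox xi * (total_sq cos xi * total_sq cos xi + total_sq sin xi *
    total_sq sin xi))
  = \int[leb]_t \int[leb]_t' corr (t, t').
Proof.
apply: (@Rintegral_bilinear _ _ _ _ _ _ _ leb leb lebd mass mass (@wbox _ d)) => //.
- exact: integrable_wbox.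
- exact: wbox_ge0.
- exact: measurable_u.
- exact: measurable_u.
- exact: measurable_u.
- exact: measurable_u.
- by move=> t xi; exact: u_le.
- by move=> t xi; exact: u_le.
- by move=> t xi; exact: u_le.
- by move=> t xi; exact: u_le.
Qed.

(** [corr] is dominated by [E1], [E2] on the strip of half-width [T] around the diagonal and by [E3]
    elsewhere. Each line crosses the strip in length $2T$, so [E1] and [E2] integrate to $2T$ times
    the total mass, while [E3] gives its square. *)
Lemma total_sq_le s : 0 < s ->
  \int[lebd]_xi (wbox xi * (total_sq cos xi * total_sq cos xi + total_sq sin xi *
    total_sq sin xi))
  <= 2 * (vdc_cst / s ^+ 2) * bessel_cst d * total + s ^+ d * total ^+ 2.
Proof.
move=> s0; rewrite corr_total.
set T := vdc_cst / s ^+ 2.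
have T0 : 0 < T by rewrite divr_gt0 ?exprn_gt0// vdc_cst_gt0.
have mmass := measurable_of_integrable imass.
have M0 : 0 <= bessel_cst d / 2 :> R by rewrite divr_ge0// bessel_cst_ge0.
have sd0 : 0 <= s ^+ d by rewrite exprn_ge0// ltW.
pose E1 (z : RT * RT) : \bar R := (near_ind T z * mass z.1)%:E.
pose E2 (z : RT * RT) : \bar R := (near_ind T z * mass z.2)%:E.
pose E3 (z : RT * RT) : \bar R := (mass z.1 * mass z.2)%:E.
have mE1 : measurable_fun setT E1.
  by apply/measurable_EFinP/measurable_funM => //; exact: (measurableT_comp mmass).
have mE2 : measurable_fun setT E2.
  by apply/measurable_EFinP/measurable_funM => //; exact: (measurableT_comp mmass).
have mE3 : measurable_fun setT E3.
  by apply/measurable_EFinP/measurable_funM; exact: (measurableT_comp mmass).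
have n0 z : 0 <= near_ind T z by exact: ler0n.
have E10 z : (0 <= E1 z)%E by rewrite lee_fin mulr_ge0.
have E20 z : (0 <= E2 z)%E by rewrite lee_fin mulr_ge0.
have E30 z : (0 <= E3 z)%E by rewrite lee_fin mulr_ge0.
have intmass : (\int[leb]_t (mass t)%:E = total%:E)%E.
  by rewrite totalE (EFin_Rintegral imass).
have I1t t : (\int[leb]_t' E1 (t, t') = (2 * T)%:E * (mass t)%:E)%E.
  under eq_integral do rewrite /E1 EFinM /=.
  rewrite ge0_integralZr//.
  - by rewrite integral_near_ind.
  - by apply/measurable_EFinP; exact: (measurableT_comp (measurable_near_ind T)
    (measurable_pair1 t)).
  - by move=> t' _; rewrite lee_fin.
  - by rewrite lee_fin.
have I1 : (\int[leb]_t \int[leb]_t' E1 (t, t') = (2 * T * total)%:E)%E.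
  under eq_integral do rewrite I1t.
  rewrite ge0_integralZl//.
  - by rewrite intmass -EFinM.
  - exact/measurable_EFinP.
  - by move=> t _; rewrite lee_fin.
  - by rewrite lee_fin mulr_ge0// ltW.
(* The strip is symmetric, so Tonelli exchanges [E2] with [E1]. *)
have I2 : (\int[leb]_t \int[leb]_t' E2 (t, t') = (2 * T * total)%:E)%E.
  rewrite (fubini_tonelli E2 mE2 E20) -I1.
  apply: eq_integral => t _; apply: eq_integral => t' _.
  by rewrite /E1 /E2 /near_ind/= distrC.
have I3t t : (\int[leb]_t' E3 (t, t') = (mass t)%:E * total%:E)%E.
  under eq_integral do rewrite /E3 EFinM /=.
  rewrite ge0_integralZl//.
  - by rewrite intmass.
  - exact/measurable_EFinP.
  - by move=> t' _; rewrite lee_fin.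
  - by rewrite lee_fin.
have I3 : (\int[leb]_t \int[leb]_t' E3 (t, t') = (total ^+ 2)%:E)%E.
  under eq_integral do rewrite I3t.
  rewrite ge0_integralZr//.
  - by rewrite intmass -EFinM expr2.
  - exact/measurable_EFinP.
  - by move=> t _; rewrite lee_fin.
  - by rewrite lee_fin totalE; apply: Rintegral_ge0.
(* The term [E3] is kept on the strip too: it is nonnegative there, and its double integral factors
   only without a cutoff. *)
have bd t t' : (`|(corr (t, t'))%:E| <= (bessel_cst d / 2)%:E * E1 (t, t') +
    ((bessel_cst d / 2)%:E * E2 (t, t') + (s ^+ d)%:E * E3 (t, t')))%E.
  rewrite /E1 /E2 /E3 -!EFinM -!EFinD lee_fin /near_ind /=.
  have [tt|tt] := ltP `|t - t'| T.
    have := corr_near t t'; rewrite !mul1r => h.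
    rewrite addrA -mulrDr (le_trans h)// lerDl.
    by rewrite !mulr_ge0.
  by rewrite !mul0r !mulr0 !add0r mulrA; exact: corr_far.
have mEt (E : RT * RT -> \bar R) t : measurable_fun setT E -> measurable_fun setT
  (fun t' => E (t, t')).
  by move=> mE; exact: (measurableT_comp mE (measurable_pair1 t)).
have mIE (E : RT * RT -> \bar R) : measurable_fun setT E -> (forall z, 0 <= E z)%E ->
    measurable_fun setT (fun t => \int[leb]_t' E (t, t'))%E.
  by move=> mE E0; exact: (measurable_fun_fubini_tonelli_F (m2 := leb) E mE E0).
rewrite -lee_fin.
pose Rhs (z : RT * RT) := ((bessel_cst d / 2)%:E * E1 z +
    ((bessel_cst d / 2)%:E * E2 z + (s ^+ d)%:E * E3 z))%E.
have mRhs : measurable_fun setT Rhs.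
  by apply: emeasurable_funD; [|apply: emeasurable_funD]; exact: emeasurable_funM.
have Rhs0 z : (0 <= Rhs z)%E.
  by rewrite !adde_ge0// mule_ge0.
have ie0 (E : RT * RT -> \bar R) t : (forall z, 0 <= E z)%E -> (0 <= \int[leb]_t' E
  (t, t'))%E.
  by move=> E0; apply: integral_ge0 => t' _; exact: E0.
have mc (k : R) (E : RT -> \bar R) : measurable_fun setT E -> measurable_fun setT
  (fun t => k%:E * E t)%E.
  by move=> mE; exact: emeasurable_funM.
have lin (k1 k2 k3 : R) (F1 F2 F3 : RT -> \bar R) :
    0 <= k1 -> 0 <= k2 -> 0 <= k3 ->
    measurable_fun setT F1 -> measurable_fun setT F2 -> measurable_fun setT F3 ->
    (forall t, 0 <= F1 t)%E -> (forall t, 0 <= F2 t)%E -> (forall t, 0 <= F3 t)%E ->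
    (\int[leb]_t (k1%:E * F1 t + (k2%:E * F2 t + k3%:E * F3 t)) =
     k1%:E * \int[leb]_t F1 t + (k2%:E * \int[leb]_t F2 t + k3%:E * \int[leb]_t F3 t))%E.
  move=> k10 k20 k30 m1 m2 m3 F10 F20 F30.
  have kF k (F : RT -> \bar R) t : 0 <= k -> (forall t, 0 <= F t)%E -> (0 <= k%:E * F
    t)%E.
    by move=> k0 F0; rewrite mule_ge0.
  rewrite ge0_integralD//; last 4 first.
  - by move=> t _; exact: kF.
  - exact: mc.
  - by move=> t _; apply: adde_ge0; exact: kF.
  - by apply: emeasurable_funD; exact: mc.
  rewrite ge0_integralD//; last 4 first.
  - by move=> t _; exact: kF.
  - exact: mc.
  - by move=> t _; exact: kF.
  - exact: mc.
  by rewrite !ge0_integralZl.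
have -> : ((2 * T * bessel_cst d * total + s ^+ d * total ^+ 2)%:E =
    \int[leb]_t \int[leb]_t' Rhs (t, t'))%E.
  transitivity (\int[leb]_t ((bessel_cst d / 2)%:E * (\int[leb]_t' E1 (t, t')) +
    ((bessel_cst d / 2)%:E * (\int[leb]_t' E2 (t, t')) +
     (s ^+ d)%:E * \int[leb]_t' E3 (t, t'))))%E.
    rewrite lin//; try exact: mIE; try by move=> t; exact: ie0.
    by rewrite I1 I2 I3 -!EFinM -!EFinD; congr EFin; field.
  by apply: eq_integral => t _; rewrite lin//; exact: mEt.
(* The absolute value is moved inside one integral at a time in extended reals, which asks only for
   measurability of [corr]. *)
apply: (@le_trans _ _ (`|\int[leb]_t \int[leb]_t' corr (t, t')|%:E)%E).
  by rewrite lee_fin ler_norm.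
apply: (le_trans (norm_Rintegral_le_ereal _ _)).
  exact: (measurable_Rintegral leb measurable_corr).
apply: ge0_le_integral => //.
- by apply/measurable_EFinP; apply: measurableT_comp => //; exact:
  (measurable_Rintegral leb measurable_corr).
- exact: mIE.
move=> t _.
apply: (le_trans (norm_Rintegral_le_ereal _ _)).
  exact: (measurableT_comp measurable_corr (measurable_pair1 t)).
apply: ge0_le_integral => //.
- by apply/measurable_EFinP; apply: measurableT_comp => //; exact: (measurableT_comp
  measurable_corr (measurable_pair1 t)).
- exact: mEt.
by move=> t' _; exact: bd.
Qed.

End TimeSlices.

(** * The surface measure of the paraboloid *)

Section SurfaceMeasure.
Context {R : realType} (n : nat).
Notation lebd := (@lebesgue_Rn R n.-1).
Notation sigma := (@surface_measure R n).

Definition parab_base (x : n.-tuple R) : n.-1.-tuple R :=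
  [tuple nth 0 x i | i < n.-1].

Lemma parab_ptK : cancel (@parab_pt R n) parab_base.
Proof.
move=> xi; apply: eq_from_tnth => i; rewrite tnth_mktuple.
have lin : (i < n)%N by rewrite (leq_trans (ltn_ord i))// leq_pred.
rewrite -[X in nth 0 _ X]/(nat_of_ord (Ordinal lin)) -tnth_nth tnth_mktuple /=.
by rewrite -tnth_nth.
Qed.

Lemma measurable_parab_base : measurable_fun setT parab_base.
Proof.
apply/measurable_fun_tnthP => i.
have lin : (i < n)%N by rewrite (leq_trans (ltn_ord i))// leq_pred.
rewrite [X in measurable_fun _ X](_ : _ = (fun x : n.-tuple R => tnth x (Ordinal lin))).
  exact: measurable_tnth.
by apply/funext => x /=; rewrite tnth_mktuple (tnth_nth 0).
Qed.

Lemma preimage_paraboloid : @parab_pt R n @^-1` @paraboloid R n = @cube R n.-1.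
Proof.
apply/seteqP; split => xi /=; last by exists xi.
by move=> [eta etac] /(can_inj parab_ptK) <-.
Qed.

(** Images need not be measurable, but this one is cut out by equations: it consists of the points
    whose base lies in the cube and which are fixed by projecting to the base and lifting back. *)
Lemma measurable_paraboloid : measurable (@paraboloid R n).
Proof.
rewrite (_ : @paraboloid R n = parab_base @^-1` @cube R n.-1 `&`
  \bigcap_(i in [set: 'I_n])
    ((fun x : n.-tuple R => tnth (parab_pt (parab_base x)) i - tnth x i) @^-1` [set 0])).
  apply: measurableI.
    rewrite -[X in measurable X]setTI; apply: measurable_parab_base => //.
    exact: measurable_cube.
  apply: fin_bigcap_measurable => // i _.
  have mh : measurable_fun setT
      (fun x : n.-tuple R => tnth (parab_pt (parab_base x)) i - tnth x i).
    apply: measurable_funB; last exact: measurable_tnth.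
    apply: (measurableT_comp (measurable_tnth i)).
    exact: (measurableT_comp (@measurable_parab_pt R n) measurable_parab_base).
  by rewrite -[X in measurable X]setTI; exact: mh.
apply/seteqP; split => [x [xi cxi <-]|x [cx h]].
  by split => [|i _] /=; rewrite parab_ptK ?subrr.
exists (parab_base x) => //; apply: eq_from_tnth => i.
by apply/eqP; rewrite -subr_eq0; apply/eqP; exact: h.
Qed.

(** The maximum of the area density over the cube, reached at its corners. *)
Definition area_cst : R := Num.sqrt (1 + 4 * n.-1%:R).

Lemma area_cst_gt0 : 0 < area_cst.
Proof. by rewrite sqrtr_gt0 ltr_pwDl// mulr_ge0. Qed.

Lemma area_le (xi : n.-1.-tuple R) : cube xi -> Num.sqrt (1 + 4 * sqnorm xi) <= area_cst.
Proof.
move=> cxi; rewrite ler_sqrt; last by rewrite addr_ge0// mulr_ge0.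
rewrite lerD2l ler_pM2l// /sqnorm /dotp.
rewrite -[leRHS]mulr1 mulr_natl -[X in _ *+ X]card_ord -sumr_const.
apply: ler_sum => i _; have := cxi i; rewrite in_itv/= => /andP[? ?]; nra.
Qed.

Lemma surface_measure_setCparaboloid : sigma (~` @paraboloid R n) = 0%E.
Proof.
rewrite /surface_measure (_ : _ `&` _ = set0); first exact: integral_set0.
by apply/seteqP; split => // xi [cxi]; apply; exists xi.
Qed.

Lemma surface_measure_le A : measurable A ->
  (sigma A <= area_cst%:E * lebd (@parab_pt R n @^-1` A))%E.
Proof.
move=> mA; rewrite /surface_measure.
have mpt : measurable (@parab_pt R n @^-1` A).
  by rewrite -[X in measurable X]setTI; exact: measurable_parab_pt.
have mI : measurable (@cube R n.-1 `&` @parab_pt R n @^-1` A).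
  by apply: measurableI => //; exact: measurable_cube.
apply: (@le_trans _ _ (\int[lebd]_(xi in @cube R n.-1 `&` @parab_pt R n @^-1` A) (cst
  area_cst%:E) xi)%E).
  apply: ge0_le_integral => //.
  - by apply: measurable_funTS; exact: measurable_surface_density.
  - by move=> x [cx _]; rewrite lee_fin area_le.
rewrite integral_cst//; apply: lee_wpmul2l; first by rewrite lee_fin ltW// area_cst_gt0.
by apply: le_measure; rewrite ?inE.
Qed.

(** The surface measure is at most [area_cst] times the image of Lebesgue measure under [parab_pt].
    Pulling back gives an integral over the cube, where the weight is at least 1, and the weighted
    integrand may then be integrated over the whole space. *)
Lemma integral_surface_le (f : n.-tuple R -> \bar R) :
  measurable_fun setT f -> (forall x, 0 <= f x)%E ->
  (\int[sigma]_x f x <=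
   area_cst%:E * \int[lebd]_xi ((wbox xi)%:E * f (parab_pt xi)))%E.
Proof.
move=> mf f0; have mP := measurable_paraboloid.
have mpt := @measurable_parab_pt R n.
have mC : measurable (~` @paraboloid R n) by exact: measurableC.
(* The integral is first restricted to the paraboloid, because the dominating image measure charges
   the whole unbounded graph. *)
rewrite (ge0_negligible_integral mC measurableT mf (fun x _ => f0 x)
  surface_measure_setCparaboloid) setTD setCK.
pose m2 : {measure set (n.-tuple R) -> \bar R} :=
  measure_function_pushforward__canonical__measure_function_Measure lebd mpt.
pose W := NngNum (ltW area_cst_gt0).
have m12 S : measurable S -> (sigma S <= mscale W m2 S)%E by exact: surface_measure_le.
apply: (le_trans (ge0_le_measure_integral m12 mP f0 mf)).
rewrite ge0_integral_mscale//; last exact: measurable_funTS.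
apply: lee_wpmul2l; first by rewrite lee_fin; exact: ltW area_cst_gt0.
rewrite ge0_integral_pushforward//; last exact: measurable_funTS.
rewrite preimage_paraboloid.
have mfpt : measurable_fun setT (fun xi => (wbox xi)%:E * f (parab_pt xi))%E.
  apply: emeasurable_funM; first by apply/measurable_EFinP; exact: measurable_wbox.
  exact: measurableT_comp.
have wf0 xi : (0 <= (wbox xi)%:E * f (parab_pt xi))%E.
  by rewrite mule_ge0// lee_fin wbox_ge0.
apply: (@le_trans _ _ (\int[lebd]_(xi in @cube R n.-1) ((wbox xi)%:E * f (parab_pt
  xi)))%E).
  apply: ge0_le_integral => //.
  - exact: measurable_cube.
  - by move=> xi _; exact: f0.
  - by apply: measurable_funTS; exact: measurableT_comp.
  - exact: measurable_funTS.
  - move=> xi cxi /=; rewrite -[leLHS]mul1e lee_wpmul2r// lee_fin.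
    exact: wbox_ge1.
by apply: ge0_subset_integral => //; exact: measurable_cube.
Qed.

Lemma surface_measure_fin : fin_num_fun sigma.
Proof.
apply: lty_fin_num_fun.
have := @integral_surface_le (cst 1%E) (measurable_cst _) (fun _ => lee01).
rewrite integral_cst// mul1e => /le_lt_trans; apply.
under eq_integral do rewrite mule1.
apply: lte_mul_pinfty => //; first by rewrite lee_fin ltW// area_cst_gt0.
by apply: integrable_lty => //; exact: integrable_wbox.
Qed.

HB.instance Definition _ := Measure_isFinite.Build _ _ _ sigma surface_measure_fin.

End SurfaceMeasure.

(** * Level sets of the extension operator *)

Section LevelSet.
Context {R : realType} (d : nat).
Notation n := d.+1.
Notation leb := (@lebesgue_measure R).
Notation RT := (measurableTypeR R).
Notation lebn := (@lebesgue_Rn R n).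
Notation lebd := (@lebesgue_Rn R d).
Notation sigma := (@surface_measure R n).

Lemma dotp_rcons_parab (t : R) (y xi : d.-tuple R) :
  2 * pi * dotp (tuple_rcons (t, y)) (@parab_pt R n xi) = phase t y xi.
Proof.
rewrite /phase /dotp big_ord_recr /=; congr (_ * (_ + _)).
  apply: eq_bigr => i _; rewrite tnth_rcons_widen tnth_mktuple /=.
  by rewrite -tnth_nth.
rewrite tnth_rcons_last tnth_mktuple /= nth_default// size_tuple//.
Qed.

Variables (u v : n.-tuple R -> R) (N : R).
Hypotheses (mu : measurable_fun setT u) (mv : measurable_fun setT v).
Hypothesis N0 : 0 < N.
Hypothesis uvN : (\int[sigma]_w ((u w) ^+ 2 + (v w) ^+ 2)%:E <= (N ^+ 2)%:E)%E.

Let F (z : n.-tuple R * n.-tuple R) :=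
  u z.2 * cos (2 * pi * dotp z.1 z.2) + v z.2 * sin (2 * pi * dotp z.1 z.2).

(* The shape of both real and imaginary parts of [extension_op f], up to sign. *)
Definition real_ext (x : n.-tuple R) : R := \int[sigma]_w F (x, w).

Let mtrig (f : R -> R) : continuous f ->
  measurable_fun setT (fun z : n.-tuple R * n.-tuple R => f (2 * pi * dotp z.1 z.2)).
Proof.
move=> cf; apply: (measurableT_comp (continuous_measurable_fun cf)).
by apply: measurable_funM => //; exact: measurable_dotp.
Qed.

Let mF : measurable_fun setT F.
Proof.
apply: measurable_funD; apply: measurable_funM.
- exact: (measurableT_comp mu).
- exact: mtrig (@continuous_cos R).
- exact: (measurableT_comp mv).
- exact: mtrig (@continuous_sin R).
Qed.

Lemma measurable_real_ext : measurable_fun setT real_ext.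
Proof. exact: (measurable_Rintegral sigma mF). Qed.

Let isq : sigma.-integrable setT (EFin \o (fun w => u w ^+ 2 + v w ^+ 2)).
Proof.
apply: (@integrable_of_le _ _ _ _ _ (N ^+ 2)).
  by apply: measurable_funD; exact: measurable_funX.
under eq_integral do rewrite abse_EFin ger0_norm ?addr_ge0 ?sqr_ge0//.
exact: uvN.
Qed.

(** A majorant of $|u|+|v|$ by $|u| \le u^2/(2N)+N/2$; it turns the $L^2$ hypothesis into
    integrability on the finite measure [sigma] without Hölder's inequality. *)
Let q w := (2 * N)^-1 * (u w ^+ 2 + v w ^+ 2) + N.

Let iN : sigma.-integrable setT (EFin \o cst N).
Proof. exact: finite_measure_integrable_cst. Qed.

Let iq : sigma.-integrable setT (EFin \o q).
Proof. by apply: integrable_add => //; exact: integrable_scale. Qed.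

Let uvq w : `|u w| + `|v w| <= q w.
Proof.
rewrite /q -(ler_pM2l (_ : 0 < 2 * N)) ?mulr_gt0// [leRHS]mulrDr mulVKf ?gt_eqF
  ?mulr_gt0//.
have := sqr_ge0 (`|u w| - N); have := sqr_ge0 (`|v w| - N).
rewrite !sqrrB !real_normK ?num_real// => *; nra.
Qed.

Let Fq x w : `|F (x, w)| <= q w.
Proof.
apply: le_trans (uvq w); apply: (le_trans (ler_normD _ _)).
by rewrite !normrM lerD// ler_piMr// ?cos_max ?sin_max.
Qed.

Let int_uv : \int[sigma]_w (u w ^+ 2 + v w ^+ 2) <= N ^+ 2.
Proof. by rewrite -lee_fin EFin_Rintegral. Qed.

Lemma integrable_real_ext x : sigma.-integrable setT (EFin \o (fun w =>
  u w * cos (2 * pi * dotp x w) + v w * sin (2 * pi * dotp x w))).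
Proof.
apply: (dominated_integrable _ (Fq x) iq).
exact: (measurableT_comp mF (measurable_pair1 x)).
Qed.

Lemma real_ext_bounded x : `|real_ext x| <= (2^-1 + fine (sigma setT)) * N.
Proof.
apply: (@le_trans _ _ (\int[sigma]_w q w)).
  apply: norm_Rintegral_le => //.
  by apply: dominated_integrable iq => //; exact: (measurableT_comp mF
    (measurable_pair1 x)).
rewrite RintegralD//; last exact: integrable_scale.
rewrite RintegralZl// Rintegral_cst//.
have -> (S : R) : (2^-1 + S) * N = (2 * N)^-1 * N ^+ 2 + N * S.
  by field; rewrite gt_eqF.
by rewrite lerD2r ler_wpM2l// invr_ge0 mulr_ge0// ltW.
Qed.

Variables (G : set (n.-tuple R)) (p : RT -> R) (r : d.-tuple R -> R) (lam : R).
Hypothesis mG : measurable G.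
Hypothesis ip : leb.-integrable setT (EFin \o p).
Hypothesis ir : lebd.-integrable setT (EFin \o r).
Hypothesis Gpr : forall t y, \1_G (tuple_rcons (t, y)) <= p t * r y.
Hypothesis lam0 : 0 < lam.
Hypothesis Glam : forall x, G x -> lam <= real_ext x.

Let g (z : RT * d.-tuple R) : R := \1_G (tuple_rcons z).

Let m1G : measurable_fun setT (\1_G : n.-tuple R -> R).
Proof. exact: measurable_indic. Qed.

Let mg : measurable_fun setT g.
Proof. exact: (measurableT_comp m1G (@measurable_tuple_rcons R d)). Qed.

Let g01 z : 0 <= g z <= 1.
Proof. by rewrite /g indicE; case: (_ \in _); rewrite /= ?lexx ?ler01. Qed.

Let gpr t y : `|g (t, y)| <= p t * r y.
Proof. by have /andP[g0 _] := g01 (t, y); rewrite ger0_norm//; exact: Gpr. Qed.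

Let i1G : lebn.-integrable setT (EFin \o (\1_G : n.-tuple R -> R)).
Proof.
apply: integrable_lebesgue_rcons => //.
exact: (integrable_dominated_product ip ir mg gpr).
Qed.

Let m := \int[lebn]_x (\1_G x : R).

Lemma lebesgue_level : lebn G = m%:E.
Proof. by rewrite /m EFin_Rintegral// integral_indic// setIT. Qed.

Let m0 : 0 <= m.
Proof. exact: Rintegral_ge0. Qed.

Let mE : m = \int[(leb \x lebd)%E]_z g z.
Proof.
rewrite /m Rintegral_lebesgue_rcons//.
exact: (integrable_dominated_product ip ir mg gpr).
Qed.

(** [T cos] and [T sin] are the components of the Fourier transform of the indicator of [G], that
    is, of the adjoint of [real_ext] applied to it. *)
Let T f w := \int[lebn]_x (\1_G x * f (2 * pi * dotp x w)).

Let b1G (f : R -> R) x (a : R) : (forall x, `|f x| <= 1) -> `|\1_G x * f a| <= \1_G x.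
Proof. by move=> f1; rewrite normrM ger0_norm// ler_piMr. Qed.

Let mT f : continuous f -> measurable_fun setT (T f).
Proof.
move=> cf.
have mH : measurable_fun setT (fun z : n.-tuple R * n.-tuple R =>
    \1_G z.2 * f (2 * pi * dotp z.2 z.1)).
  apply: measurable_funM; first exact: (measurableT_comp m1G).
  exact: (measurable_swapped (mtrig cf)).
exact: (measurable_Rintegral lebn mH).
Qed.

Let iT (f : R -> R) w : continuous f -> (forall x, `|f x| <= 1) ->
  lebn.-integrable setT (EFin \o (fun x => \1_G x * f (2 * pi * dotp x w))).
Proof.
move=> cf f1; apply: dominated_integrable i1G => //; last by move=> x; exact: b1G.
by apply: measurable_funM => //; exact: (measurableT_comp (mtrig cf)
  (measurable_pair2 w)).
Qed.

Let T_le (f : R -> R) w : continuous f -> (forall x, `|f x| <= 1) -> `|T f w| <= m.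
Proof.
move=> cf f1; apply: norm_Rintegral_le => //; first exact: iT.
by move=> x; exact: b1G.
Qed.

Let cc := @continuous_cos R. Let cs := @continuous_sin R.
Let cm := @cos_max R. Let sm := @sin_max R.

(** Integrate the lower bound [lam] for [real_ext] over [G] and exchange the integrals, which the
    majorant $1_G(x)q(w)$ allows. *)
Let duality : lam * m <= \int[sigma]_w (u w * T cos w + v w * T sin w).
Proof.
pose H (z : n.-tuple R * n.-tuple R) := \1_G z.1 * F z.
have mH : measurable_fun setT H.
  by apply: measurable_funM => //; exact: (measurableT_comp m1G).
have bH x w : `|H (x, w)| <= \1_G x * q w.
  by rewrite /H/= normrM ger0_norm// ler_wpM2l.
have <- : \int[lebn]_x \int[sigma]_w H (x, w) =
    \int[sigma]_w (u w * T cos w + v w * T sin w).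
  rewrite (Rintegral_swap i1G iq mH bH); apply: eq_Rintegral => w _.
  rewrite -!RintegralZl//; try exact: iT.
  rewrite -RintegralD//; try by apply: integrable_scale; exact: iT.
  by apply: eq_Rintegral => x _; rewrite /H /F/=; ring.
rewrite -RintegralZl//; apply: le_Rintegral => //.
- exact: integrable_scale.
- exact: (integrable_Rintegral i1G iq mH bH).
move=> x _; rewrite /H/= RintegralZl//; last first.
  by apply: dominated_integrable iq => //; exact: (measurableT_comp mF
    (measurable_pair1 x)).
rewrite -/(real_ext x) indicE; case: (boolP (x \in G)) => [/set_mem Gx|_].
  by rewrite mulr1 mul1r; exact: Glam.
by rewrite mulr0 mul0r.
Qed.

Let TT_le w : `|T cos w ^+ 2 + T sin w ^+ 2| <= 2 * m ^+ 2.
Proof.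
rewrite ger0_norm ?addr_ge0 ?sqr_ge0//.
have := T_le w cc cm; have := T_le w cs sm.
rewrite !ler_norml => /andP[? ?] /andP[? ?].
by have ? := m0; nra.
Qed.

Let iTT : sigma.-integrable setT (EFin \o (fun w => T cos w ^+ 2 + T sin w ^+ 2)).
Proof.
apply: (@dominated_integrable _ _ _ _ _ (cst (2 * m ^+ 2))).
- by apply: measurable_funD; apply: measurable_funX; exact: mT.
- exact: TT_le.
- exact: finite_measure_integrable_cst.
Qed.

Let SS := \int[sigma]_w (T cos w ^+ 2 + T sin w ^+ 2).

(** Cauchy-Schwarz in its additive form, integrated from a pointwise inequality of squares; [tau] is
    optimized afterwards. *)
Let cauchy_schwarz tau : 0 < tau ->
  lam * m <= tau / 2 * N ^+ 2 + (2 * tau)^-1 * SS.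
Proof.
move=> tau0; apply: (le_trans duality).
have i2 := integrable_scale (tau / 2) isq.
have i3 := integrable_scale ((2 * tau)^-1) iTT.
apply: (@le_trans _ _ (\int[sigma]_w (tau / 2 * (u w ^+ 2 + v w ^+ 2) +
   (2 * tau)^-1 * (T cos w ^+ 2 + T sin w ^+ 2)))); last first.
  rewrite RintegralD// !RintegralZl// lerD2r ler_wpM2l// divr_ge0// ltW//.
have pt w : `|u w * T cos w + v w * T sin w| <= tau / 2 * (u w ^+ 2 + v w ^+ 2) +
   (2 * tau)^-1 * (T cos w ^+ 2 + T sin w ^+ 2).
  set a := T cos w; set b := T sin w; set x := u w; set y := v w.
  rewrite -(ler_pM2l (_ : 0 < 2 * tau)) ?mulr_gt0// [leRHS]mulrDr mulVKf ?gt_eqF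
    ?mulr_gt0//.
  rewrite -[X in X * `|_|](@ger0_norm _ (2 * tau)) ?mulr_ge0 ?(ltW tau0)// -normrM
    ler_norml.
  have := sqr_ge0 (tau * x - a); have := sqr_ge0 (tau * y - b).
  have := sqr_ge0 (tau * x + a); have := sqr_ge0 (tau * y + b).
  move=> *; apply/andP; split; nra.
apply: le_Rintegral => //.
- apply: (dominated_integrable _ pt); last exact: integrable_add.
  by apply: measurable_funD; apply: measurable_funM => //; exact: mT.
- exact: integrable_add.
- by move=> w _; rewrite (le_trans _ (pt w))// ler_norm.
Qed.

Let T_parab f xi : continuous f -> (forall x, `|f x| <= 1) ->
  T f (@parab_pt R n xi) = \int[leb]_t \int[lebd]_y (g (t, y) * f (phase t y xi)).
Proof.
move=> cf f1.
have mE' z : \1_G (tuple_rcons z) * f (2 * pi * dotp (tuple_rcons z) (@parab_pt R n xi)) =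
    g z * f (phase z.1 z.2 xi).
  by case: z => t y; rewrite dotp_rcons_parab.
have mgf : measurable_fun setT (fun z : RT * d.-tuple R => g z * f (phase z.1 z.2 xi)).
  apply: measurable_funM => //; apply: (measurableT_comp (continuous_measurable_fun cf)).
  exact: measurable_phase.
have gfpr t y : `|g (t, y) * f (phase t y xi)| <= p t * r y.
  by rewrite normrM (le_trans _ (gpr t y))// ler_piMr.
have i2 := integrable_dominated_product ip ir mgf gfpr.
rewrite /T Rintegral_lebesgue_rcons.
- rewrite (funext mE') -(Rintegral_iterated ip ir mgf gfpr)//.
- apply: measurable_funM => //; exact: (measurableT_comp (mtrig cf) (measurable_pair2 _)).
- by rewrite (funext mE').
Qed.

(** The Fourier transform of the indicator at [parab_pt xi] is an iterated integral over time
    slices, so passing from [sigma] to the weight makes [total_sq_le] applicable. *)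
Let SS_le s : 0 < s ->
  SS <= area_cst n * (2 * (vdc_cst / s ^+ 2) * bessel_cst d * m + s ^+ d * m ^+ 2).
Proof.
move=> s0.
have := total_sq_le mg g01 ip ir gpr s0; rewrite -mE => Sle.
rewrite -lee_fin /SS EFin_Rintegral//.
have mTT : measurable_fun setT (fun w => (T cos w ^+ 2 + T sin w ^+ 2)%:E).
  by apply/measurable_EFinP/measurable_funD; apply: measurable_funX; exact: mT.
have TT0 w : (0 <= (T cos w ^+ 2 + T sin w ^+ 2)%:E)%E.
  by rewrite lee_fin addr_ge0 ?sqr_ge0.
apply: (le_trans (integral_surface_le mTT TT0)).
rewrite EFinM; apply: lee_wpmul2l; first by rewrite lee_fin ltW// area_cst_gt0.
pose Q xi := wbox xi * (T cos (@parab_pt R n xi) ^+ 2 + T sin (@parab_pt R n xi) ^+ 2).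
rewrite (_ : \int[lebd]_xi _ = \int[lebd]_xi Q xi) in Sle; last first.
  by apply: eq_Rintegral => xi _; rewrite /Q !T_parab// !expr2.
have iQ : lebd.-integrable setT (EFin \o Q).
  apply: (@dominated_integrable _ _ _ _ _ (fun xi => (2 * m ^+ 2) * wbox xi)).
  - apply: measurable_funM; first exact: measurable_wbox.
    by apply: measurable_funD; apply: measurable_funX;
      exact: (measurableT_comp (mT _) (@measurable_parab_pt R n)).
  - move=> xi; rewrite /Q normrM ger0_norm ?wbox_ge0// mulrC ler_wpM2r ?wbox_ge0//.
  - apply: integrable_scale; exact: integrable_wbox.
by move: Sle; rewrite -lee_fin EFin_Rintegral//; apply: le_trans.
Qed.

Lemma level_set_bound s : 0 < s ->
  lam ^+ 2 * m ^+ 2 <=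
  N ^+ 2 * (area_cst n * (2 * (vdc_cst / s ^+ 2) * bessel_cst d * m + s ^+ d * m ^+ 2)).
Proof.
move=> s0; apply: le_trans (ler_wpM2l (sqr_ge0 N) (SS_le s0)).
have [m00|mp] := leP m 0.
  have -> : m = 0 by apply/eqP; rewrite eq_le m00 m0.
  rewrite expr0n mulr0 mulr_ge0 ?sqr_ge0//.
  by apply: Rintegral_ge0 => w _; rewrite addr_ge0 ?sqr_ge0.
(* This [tau] makes the first term of [cauchy_schwarz] half of the left-hand side; it is positive
   only for positive [m], hence the separate case before. *)
have tau0 : 0 < lam * m / N ^+ 2 by rewrite divr_gt0 ?mulr_gt0 ?exprn_gt0.
have := cauchy_schwarz tau0.
move: mp; set M := m; set S := SS => mp.
have -> : lam * M / N ^+ 2 / 2 * N ^+ 2 + (2 * (lam * M / N ^+ 2))^-1 * S =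
    ((lam * M) ^+ 2 + N ^+ 2 * S) / (2 * (lam * M)).
  by field; rewrite !gt_eqF.
rewrite ler_pdivlMr ?mulr_gt0// -exprMn; lra.
Qed.

End LevelSet.

Lemma integrable_indic_lty dd (T : measurableType dd) (R : realType)
    (mu : {measure set T -> \bar R}) (A : set T) : measurable A ->
  (mu A < +oo)%E -> mu.-integrable setT (EFin \o (\1_A : T -> R)).
Proof.
move=> mA Aoo; apply/integrableP; split; first exact/measurable_EFinP.
under eq_integral do rewrite /= ger0_norm//.
by rewrite integral_indic// setIT.
Qed.

Section LevelSets.
Context {R : realType} (d : nat).
Notation n := d.+1.
Notation lebn := (@lebesgue_Rn R n).
Notation sigma := (@surface_measure R n).
Hypothesis d0 : (0 < d)%N.

Definition crit_exp : R := 2 + 4 / d%:R.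

Definition level_cst : R :=
  4 * area_cst n * vdc_cst * bessel_cst d * (2 * area_cst n) `^ (2 / d%:R).

Lemma level_cst_ge0 : 0 <= level_cst.
Proof.
have W0 := ltW (@area_cst_gt0 R n); have V0 := ltW (@vdc_cst_gt0 R).
apply: mulr_ge0; last exact: powR_ge0.
apply: mulr_ge0; last exact: bessel_cst_ge0.
by apply: mulr_ge0 => //; exact: mulr_ge0.
Qed.

(* [s] is chosen so that the quadratic term is half of the left-hand side. *)
Lemma level_set_optimize (N lam m : R) : 0 < N -> 0 < lam -> 0 <= m ->
  (forall s, 0 < s -> lam ^+ 2 * m ^+ 2 <= N ^+ 2 * (area_cst n *
     (2 * (vdc_cst / s ^+ 2) * bessel_cst d * m + s ^+ d * m ^+ 2))) ->
  m <= level_cst * (N / lam) `^ crit_exp.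
Proof.
move=> N0 lam0; rewrite le_eqVlt => /predU1P[<-|m0] H.
  by rewrite mulr_ge0 ?powR_ge0 ?level_cst_ge0.
have W0 := @area_cst_gt0 R n.
set W := (area_cst n : R) in W0 H *.
have dR0 : d%:R != 0 :> R by rewrite pnatr_eq0 -lt0n.
pose k := N / lam.
have k0 : 0 < k by rewrite divr_gt0.
pose e := 2 * W * k ^+ 2.
have e0 : 0 < e by rewrite mulr_gt0 ?exprn_gt0// mulr_gt0.
pose s := e `^ (- d%:R^-1).
have s0 : 0 < s by rewrite powR_gt0.
have sd : s ^+ d = e^-1.
  rewrite -powR_mulrn ?(ltW s0)// /s -powRrM mulNr mulVf//.
  by rewrite powR_inv1// ltW.
(* The factor $k^{4/d}$, multiplied by the $k^2$ already present in the linear term, produces the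
   critical exponent. *)
have s2 : (s ^+ 2)^-1 = (2 * W) `^ (2 / d%:R) * k `^ (4 / d%:R).
  rewrite -powR_mulrn ?(ltW s0)// -powRN /s -powRrM.
  rewrite (_ : - d%:R^-1 * - 2 = 2 / d%:R); last by ring.
  rewrite /e powRM ?sqr_ge0 ?mulr_ge0 ?(ltW W0)//; congr (_ * _).
  by rewrite -powR_mulrn ?(ltW k0)// -powRrM; congr (_ `^ _); field.
have := H s s0; rewrite sd.
have NE : N = k * lam by rewrite /k divfK// gt_eqF.
have -> : N ^+ 2 * (W * (2 * (vdc_cst / s ^+ 2) * bessel_cst d * m + e^-1 * m ^+ 2)) =
  lam ^+ 2 * m * (2 * W * vdc_cst * bessel_cst d * k ^+ 2 * (s ^+ 2)^-1) + lam ^+ 2 *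
    m ^+ 2 / 2.
  rewrite NE /e; field; rewrite !gt_eqF// ?exprn_gt0//.
move=> h.
have lm0 : 0 < lam ^+ 2 * m by rewrite mulr_gt0// exprn_gt0.
have : lam ^+ 2 * m * m <= lam ^+ 2 * m * (2 * (2 * W * vdc_cst * bessel_cst d * k ^+
  2 * (s ^+ 2)^-1)).
  by move: h; set X := (s ^+ 2)^-1; set Y := _ * X; nra.
rewrite ler_pM2l// => /le_trans; apply; rewrite le_eqVlt; apply/orP; left; apply/eqP.
rewrite s2 /crit_exp powRD; last by rewrite gt_eqF// implybT.
by rewrite -/k powR_mulrn ?(ltW k0)// /level_cst -/W; ring.
Qed.

Definition tuple_box m (k : nat) : set (m.-tuple R) :=
  [set x | forall i, tnth x i \in `[- k%:R, k%:R]].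

Lemma measurable_tuple_box m k : measurable (@tuple_box m k).
Proof.
rewrite (_ : @tuple_box m k = \bigcap_(i in [set: 'I_m])
    ((fun x : m.-tuple R => tnth x i) @^-1` `[- k%:R, k%:R])); last first.
  by apply/seteqP; split=> [x h i _|x h i]; exact: h.
apply: fin_bigcap_measurable => // i _.
by rewrite -[X in measurable X]setTI; exact: measurable_tnth.
Qed.

Lemma lebesgue_tuple_box m k : (lebesgue_Rn m (@tuple_box m k) < +oo)%E.
Proof.
rewrite [X in (X < _)%E](@lebesgue_Rn_box R m (fun=> `[- k%:R, k%:R]%classic))//.
suff : (\prod_(i < m) lebesgue_measure (`[(- k%:R)%R, k%:R%R]%classic : set
  (measurableTypeR R)))%E \is a fin_num.
  by rewrite fin_numElt => /andP[].
elim/big_ind : _ => // [x y xf yf|i _]; first by rewrite fin_numM.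
by rewrite lebesgue_measure_itv/=; case: ifP.
Qed.

Lemma bigcup_tuple_box m : \bigcup_k (@tuple_box m k) = setT.
Proof.
apply/seteqP; split => // x _.
pose M := \sum_(i < m) `|tnth x i|.
have M0 : 0 <= M by exact: sumr_ge0.
exists (Num.bound M) => // i; rewrite in_itv/= -ler_norml.
apply: (le_trans _ (ltW (archi_boundP M0))).
by rewrite /M (bigD1 i)//= lerDl sumr_ge0.
Qed.

Variables (u v : n.-tuple R -> R) (N : R).
Hypotheses (mu : measurable_fun setT u) (mv : measurable_fun setT v).
Hypothesis N0 : 0 < N.
Hypothesis uvN : (\int[sigma]_w ((u w) ^+ 2 + (v w) ^+ 2)%:E <= (N ^+ 2)%:E)%E.

(** Absorbing the quadratic term requires a finite measure to begin with, so the level set is cut by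
    boxes. The resulting bound does not depend on the box and passes to the increasing limit. *)
Lemma level_set_le lam : 0 < lam ->
  (lebn [set x | (lam <= real_ext u v x)%R] <=
   (level_cst * (N / lam) `^ crit_exp)%:E)%E.
Proof.
move=> lam0; set A := [set x | _].
have mA : measurable A.
  rewrite -[A]setTI (_ : A = real_ext u v @^-1` `[lam, +oo[%classic).
    exact: (measurable_real_ext mu mv).
  by apply/seteqP; split => x /=; rewrite in_itv/= andbT.
pose G k := A `&` @tuple_box n k.
have mG k : measurable (G k) by apply: measurableI => //; exact: measurable_tuple_box.
have GA : \bigcup_k G k = A by rewrite -setI_bigcupr bigcup_tuple_box setIT.
have ndG : nondecreasing_seq G.
  move=> i j ij; apply/subsetPset => x [Ax bx]; split => // l.
  have := bx l; rewrite !in_itv/= => /andP[h1 h2].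
  have ijR : i%:R <= j%:R :> R by rewrite ler_nat.
  by rewrite (le_trans _ h1) ?lerN2//= (le_trans h2).
have cG := nondecreasing_cvg_mu (mu := lebn) mG (bigcupT_measurable _ mG) ndG.
rewrite GA in cG.
rewrite -(cvg_lim _ cG)//; apply: lime_le; first by apply/cvg_ex; eexists; exact: cG.
apply: nearW => k /=.
have bI m : (lebesgue_Rn m).-integrable setT (EFin \o (\1_(@tuple_box m k) : m.-tuple
  R -> R)).
  apply: integrable_indic_lty; first exact: measurable_tuple_box.
  exact: lebesgue_tuple_box.
have pI : lebesgue_measure.-integrable setT (EFin \o (\1_`[- k%:R, k%:R] :
  measurableTypeR R -> R)).
  exact: integrable_indic_itv.
have Gpr t y : \1_(G k) (tuple_rcons (t, y)) <= \1_`[- k%:R, k%:R] t * \1_(@tuple_box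
  d k) y :> R.
  rewrite !indicE -natrM ler_nat mulnb.
  case: (boolP (_ \in G k)) => //= /set_mem[_ bx].
  rewrite lt0b; apply/andP; split; apply/mem_set.
    by have := bx ord_max; rewrite tnth_rcons_last.
  by move=> i; have := bx (widen_ord (leqnSn d) i); rewrite tnth_rcons_widen.
rewrite (lebesgue_level (mG k) pI (bI d) Gpr) lee_fin.
apply: level_set_optimize => //; first by apply: Rintegral_ge0.
move=> s s0; apply: (level_set_bound mu mv N0 uvN (mG k) pI (bI d) Gpr lam0 _ s0).
by move=> x [].
Qed.

End LevelSets.

(** * From a weak-type bound and boundedness to a strong-type bound *)

Section WeakToStrong.
Context dd (T : measurableType dd) (R : realType) (mu : {measure set T -> \bar R}).

Lemma geometric_eseries_le (a z : R) : 0 <= a -> 0 <= z < 1 ->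
  (\sum_(k <oo) (a * z ^+ k)%:E <= (a / (1 - z))%:E)%E.
Proof.
move=> a0 /andP[z0 z1].
apply: lime_le.
  by apply: is_cvg_nneseries => k _ _; rewrite lee_fin mulr_ge0// exprn_ge0.
apply: nearW => k /=; rewrite sumEFin lee_fin.
have -> : \sum_(0 <= i < k) a * z ^+ i = a * (1 - z ^+ k) / (1 - z).
  by have := congr1 (fun f => f k) (@geometric_seriesE R a z (negbT (lt_eqF z1))).
rewrite ler_pM2r ?invr_gt0 ?subr_gt0// ler_piMr// gerBl.
by rewrite exprn_ge0.
Qed.

(** Levels are halved downwards from [M]. The level $M2^{-k}$ contributes a multiple of
    $2^{-k(q-p)}$, a convergent geometric series as $q>p$; the factor $2^p$ comes from measuring the
    set above the next level. *)
Lemma weak_to_strong (H : T -> R) (M K p q : R) :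
  measurable_fun setT H -> (forall x, 0 <= H x <= M) -> 0 < M -> 0 <= K ->
  0 < p -> p < q ->
  (forall lam : R, (0 < lam)%R -> mu [set x | (lam < H x)%R] <= (K * lam `^ (-
    p))%:E)%E ->
  (\int[mu]_x (H x `^ q)%:E <=
   (K * M `^ (q - p) * 2 `^ p / (1 - 2 `^ (- (q - p))))%:E)%E.
Proof.
move=> mH HM M0 K0 p0 pq Hlam.
have q0 : 0 < q by apply: lt_trans pq.
pose lev k : R := M * 2^-1 ^+ k.
have lev0 k : 0 < lev k by rewrite mulr_gt0// exprn_gt0// invr_gt0.
pose S k := [set x | (lev k.+1 < H x)%R].
have mS k : measurable (S k).
  rewrite -[S k]setTI (_ : S k = H @^-1` `]lev k.+1, +oo[%classic); first exact: mH.
  by apply/seteqP; split => x /=; rewrite in_itv/= andbT.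
pose f k x : \bar R := (lev k `^ q * \1_(S k) x)%:E.
have f0 k x : (0 <= f k x)%E by rewrite lee_fin mulr_ge0 ?powR_ge0.
have mf k : measurable_fun setT (f k).
  by apply/measurable_EFinP; apply: measurable_funM => //; exact: measurable_indic.
have Hf x : ((H x `^ q)%:E <= \sum_(k <oo) f k x)%E.
  have [H0 H1] := andP (HM x).
  have [Hx0|Hx] := leP (H x) 0.
    have -> : H x = 0 by apply/eqP; rewrite eq_le Hx0 H0.
    by rewrite powR0 ?gt_eqF//; apply: nneseries_ge0 => k _ _.
  have exk : exists k, lev k.+1 < H x.
    have MH0 : 0 <= M / H x by rewrite divr_ge0// ltW.
    exists (Num.bound (M / H x)); rewrite /lev.
    have := archi_boundP MH0; rewrite ltr_pdivrMr// => h.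
    rewrite exprVn ltr_pdivrMr ?exprn_gt0//.
    apply: (lt_le_trans h); rewrite mulrC ler_wpM2l// exprS.
    set b := Num.bound _; have := ltn_expl b (isT : (1 < 2)%N).
    rewrite -(ltr_nat R) natrX => /ltW hb.
    by rewrite (le_trans hb)// ler_peMl ?exprn_ge0// ler1n.
  (* One term of the series already dominates at [x]: minimality of [k] gives [H x <= lev k], and
     for [k = 0] this is the bound by [M]. *)
  pose k := ex_minn exk.
  have [kH kmin] : lev k.+1 < H x /\ (forall j, lev j.+1 < H x -> (k <= j)%N).
    by rewrite /k; case: ex_minnP.
  have Hk : H x <= lev k.
    case: k kmin {kH} => [_|k kmin]; first by rewrite /lev expr0 mulr1.
    by rewrite leNgt; apply/negP => /kmin; rewrite ltnn.
  apply: (@le_trans _ _ (f k x)).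
    rewrite lee_fin indicE mem_set// mulr1.
    by apply: ge0_ler_powR; rewrite ?nnegrE// ltW.
  have := @nneseries_lim_ge R (f ^~ x) xpredT 0 k.+1 (fun _ _ _ => f0 _ x).
  apply: le_trans; rewrite big_nat_recr//= leeDr//.
  exact: sume_ge0.
apply: (@le_trans _ _ (\int[mu]_x \sum_(k <oo) f k x)%E).
  apply: ge0_le_integral => //.
  - by move=> x _; rewrite lee_fin powR_ge0.
  - by apply/measurable_EFinP; exact: (measurableT_comp (@measurable_powR R q)).
  - exact: ge0_emeasurable_sum.
rewrite integral_nneseries//.
pose r := 2 `^ (- (q - p)) : R.
have r01 : 0 <= r < 1.
  rewrite powR_ge0/= /r powRN invf_lt1 ?powR_gt0//.
  have := gt0_ltr_powR (_ : 0 < q - p) (_ : 1 \in Num.nneg) (_ : 2 \in Num.nneg) (_ :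
    1 < 2 :> R).
  by rewrite powR1; apply; rewrite ?subr_gt0 ?nnegrE// ltr1n.
apply: le_trans (geometric_eseries_le (_ : 0 <= K * M `^ (q - p) * 2 `^ p) r01); last
  first.
  by rewrite !mulr_ge0 ?powR_ge0.
apply: lee_nneseries => [k _ _|k _]; first by apply: integral_ge0 => x _.
under eq_integral do rewrite /f EFinM.
have -> : (\int[mu]_x ((lev k `^ q)%:E * (\1_(S k) x)%:E) = (lev k `^ q)%:E * mu (S k))%E.
  rewrite ge0_integralZl//.
  - by rewrite integral_indic// setIT.
  - by apply/measurable_EFinP; exact: measurable_indic.
  - by rewrite lee_fin powR_ge0.
apply: (@le_trans _ _ ((lev k `^ q)%:E * (K * lev k.+1 `^ (- p))%:E)%E).
  by apply: lee_wpmul2l; [rewrite lee_fin powR_ge0|exact: Hlam].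
rewrite -EFinM lee_fin le_eqVlt; apply/orP; left; apply/eqP.
have lev1 : lev k.+1 = lev k * 2^-1 by rewrite /lev exprSr mulrA.
have -> : lev k.+1 `^ (- p) = lev k `^ (- p) * 2 `^ p.
  rewrite lev1 powRM ?(ltW (lev0 k))// ?invr_ge0//; congr (_ * _).
  by rewrite -[2^-1]powR_inv1// -powRrM mulN1r opprK.
have levq : lev k `^ q = lev k `^ (q - p) * lev k `^ p.
  by rewrite -powRD ?subrK// gt_eqF ?lev0// implybT.
have lp : lev k `^ p * lev k `^ (- p) = 1.
  by rewrite powRN mulfV// gt_eqF// powR_gt0.
have levr : lev k `^ (q - p) = M `^ (q - p) * r ^+ k.
  rewrite /lev powRM ?(ltW M0)// ?exprn_ge0 ?invr_ge0//; congr (_ * _).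
  rewrite exprVn -powR_invn// -powRrM.
  by rewrite -powR_mulrn ?powR_ge0// /r -powRrM; congr (_ `^ _); ring.
rewrite levq levr -[RHS]mulr1 -lp; ring.
Qed.

End WeakToStrong.

(** * From level sets to L^q norms *)

Section ExtensionOperator.
Context {R : realType} (d : nat).
Notation n := d.+1.
Notation lebn := (@lebesgue_Rn R n).
Notation sigma := (@surface_measure R n).
Notation P := (@paraboloid R n).

Lemma real_ext_opp (u v : n.-tuple R -> R) (N : R) x :
  measurable_fun setT u -> measurable_fun setT v -> 0 < N ->
  (\int[sigma]_w ((u w) ^+ 2 + (v w) ^+ 2)%:E <= (N ^+ 2)%:E)%E ->
  real_ext (fun w => - u w) (fun w => - v w) x = - real_ext u v x.
Proof.
move=> mu mv N0 uvN; rewrite /real_ext -[RHS]mulN1r -RintegralZl//; last first.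
  exact: (integrable_real_ext mu mv N0 uvN x).
by apply: eq_Rintegral => w _ /=; ring.
Qed.

Let re (f : n.-tuple R -> R[i]) := (fun w => complex.Re (f w)) \_ P.
Let im (f : n.-tuple R -> R[i]) := (fun w => complex.Im (f w)) \_ P.
Let imN (f : n.-tuple R -> R[i]) w := - im f w.

(** From $\mathrm{Re}((a+ib)e^{i\theta}) = a\cos\theta - b\sin\theta$, hence the sign in [imN]. The
    imaginary part is $b\cos\theta+a\sin\theta$, which exchanges the two roles. *)
Let ext_re f x : complex.Re (@extension_op R n f x) = real_ext (re f) (imN f) x.
Proof.
rewrite /extension_op /cintegral/= /real_ext [LHS]Rintegral_mkcond.
apply: eq_Rintegral => w _; rewrite /re /imN /im !patchE.
case: ifP => _; last by rewrite !mul0r oppr0 mul0r addr0.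
by case: (f w) => a b /=; rewrite mulNr.
Qed.

Let ext_im f x : complex.Im (@extension_op R n f x) = real_ext (im f) (re f) x.
Proof.
rewrite /extension_op /cintegral/= /real_ext [LHS]Rintegral_mkcond.
apply: eq_Rintegral => w _; rewrite /re /im !patchE.
case: ifP => _; last by rewrite !mul0r addr0.
by case: (f w) => a b /=; rewrite addrC.
Qed.

Definition energy (f : n.-tuple R -> R[i]) := (\int[sigma]_w (re f w ^+ 2 + im f w ^+
  2)%:E)%E.

Lemma cLnorm2E f : cLnorm sigma P 2%:E f = (energy f `^ 2^-1)%E.
Proof.
rewrite /cLnorm unlock /energy; congr (_ `^ _)%E.
apply: eq_integral => w _; rewrite /re /im !patchE; case: ifP => _.
  case: (f w) => a b; rewrite /Normc.normc /= ger0_norm ?sqrtr_ge0//.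
  by rewrite powR_mulrn ?sqrtr_ge0// sqr_sqrtr// addr_ge0 ?sqr_ge0.
rewrite -[X in (`|X| `^ _)%E]/(0%:E) abse0 poweR0r ?pnatr_eq0//.
by rewrite -[X in (X ^+ 2 + _)]/0 -[X in (_ + X ^+ 2)]/0 expr0n addr0.
Qed.

Lemma energy_ge0 f : (0 <= energy f)%E.
Proof. by apply: integral_ge0 => w _; rewrite lee_fin addr_ge0 ?sqr_ge0. Qed.

Section Bounds.
Variables (f : n.-tuple R -> R[i]) (N : R).
Hypothesis mf : cmeasurable_fun P f.
Hypothesis N0 : 0 < N.
Hypothesis fN : (energy f <= (N ^+ 2)%:E)%E.

Let mre : measurable_fun setT (re f).
Proof. exact: ((measurable_restrictT _ (@measurable_paraboloid R n)).1 (proj1 mf)). Qed.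

Let mim : measurable_fun setT (im f).
Proof. exact: ((measurable_restrictT _ (@measurable_paraboloid R n)).1 (proj2 mf)). Qed.

Let mreN : measurable_fun setT (fun w => - re f w).
Proof. exact: measurable_funN. Qed.

Let mimN : measurable_fun setT (imN f).
Proof. exact: measurable_funN. Qed.

Let mimNN : measurable_fun setT (fun w => - imN f w).
Proof. exact: measurable_funN. Qed.

(** This and the next three facts are the hypothesis on the energy for the coefficient pairs of
    $\pm\mathrm{Re}\,Ef$ and $\pm\mathrm{Im}\,Ef$. *)
Let fN1 : (\int[sigma]_w (re f w ^+ 2 + imN f w ^+ 2)%:E <= (N ^+ 2)%:E)%E.
Proof. by under eq_integral do rewrite /imN sqrrN; exact: fN. Qed.

Let fN2 : (\int[sigma]_w (im f w ^+ 2 + re f w ^+ 2)%:E <= (N ^+ 2)%:E)%E.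
Proof. by under eq_integral do rewrite addrC; exact: fN. Qed.

Let fN3 : (\int[sigma]_w ((- re f w) ^+ 2 + (- imN f w) ^+ 2)%:E <= (N ^+ 2)%:E)%E.
Proof. by under eq_integral do rewrite !sqrrN; exact: fN. Qed.

Let fN4 : (\int[sigma]_w ((- im f w) ^+ 2 + (- re f w) ^+ 2)%:E <= (N ^+ 2)%:E)%E.
Proof. by under eq_integral do rewrite !sqrrN; exact: fN2. Qed.

Let hre x := real_ext (re f) (imN f) x.
Let him x := real_ext (im f) (re f) x.

Let mhre : measurable_fun setT hre. Proof. exact: measurable_real_ext. Qed.
Let mhim : measurable_fun setT him. Proof. exact: measurable_real_ext. Qed.

Lemma cmeasurable_extension : cmeasurable_fun setT (@extension_op R n f).
Proof.
split; first by rewrite (funext (ext_re f)).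
by rewrite (funext (ext_im f)).
Qed.

Let H x := Normc.normc (@extension_op R n f x).

Let HE x : H x = Num.sqrt (hre x ^+ 2 + him x ^+ 2).
Proof.
by rewrite /H /hre /him -ext_re -ext_im; case: (extension_op f x).
Qed.

Let mH : measurable_fun setT H.
Proof.
rewrite (funext HE).
apply: (measurableT_comp (continuous_measurable_fun (@sqrt_continuous R))).
by apply: measurable_funD; exact: measurable_funX.
Qed.

Let H_le x : H x <= `|hre x| + `|him x|.
Proof.
rewrite HE -[leRHS]ger0_norm ?addr_ge0// -sqrtr_sqr ler_sqrt ?sqr_ge0//.
rewrite sqrrD !real_normK ?num_real// addrAC lerDl mulrn_wge0// mulr_ge0//.
Qed.

Definition sup_cst : R := 2 * (2^-1 + fine (sigma setT)).

Lemma sup_cst_gt0 : 0 < sup_cst.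
Proof. by rewrite mulr_gt0// ltr_pwDl// fine_ge0. Qed.

Let H_bounded x : 0 <= H x <= sup_cst * N.
Proof.
rewrite {1}HE sqrtr_ge0/=; apply: (le_trans (H_le x)).
have h1 := real_ext_bounded mre mimN N0 fN1 x.
have h2 := real_ext_bounded mim mre N0 fN2 x.
by rewrite (le_trans (lerD h1 h2))// /sup_cst -mulrA -mulr2n mulr_natl.
Qed.

Lemma extension_sup : (cLnorm lebn setT +oo%E (@extension_op R n f) <= (sup_cst *
  N)%:E)%E.
Proof.
(* The $L^\infty$ norm is defined by cases and equals 0 over a null space; otherwise it is an
   essential supremum. *)
rewrite /cLnorm unlock; case: ifP => _; last first.
  by rewrite lee_fin mulr_ge0// ltW// sup_cst_gt0.
apply/ess_supP; apply: nearW => x /=; rewrite patch_setT /= lee_fin.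
have /andP[h0 h1] := H_bounded x.
by rewrite ger0_norm.
Qed.

Hypothesis d0 : (0 < d)%N.

(** If $|Ef|>\lambda$, then the real or the imaginary part is at least $\lambda/2$ in absolute
    value; this gives four one-sided level sets at height $\lambda/2$, whence the factor 4 and
    [2 * N]. *)
Let level lam : (0 < lam)%R ->
  (lebn [set x | (lam < H x)%R] <=
   (4 * level_cst d * (2 * N) `^ crit_exp d * lam `^ (- crit_exp d))%:E)%E.
Proof.
move=> lam0; have l20 : 0 < lam / 2 by rewrite divr_gt0.
set B := level_cst d * (N / (lam / 2)) `^ crit_exp d.
have -> : 4 * level_cst d * (2 * N) `^ crit_exp d * lam `^ (- crit_exp d) = B + B +
  (B + B).
  rewrite /B (_ : N / (lam / 2) = (2 * N) * lam^-1); last by field; rewrite gt_eqF.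
  rewrite [(2 * N * lam^-1) `^ _]powRM ?invr_ge0 ?mulr_ge0 ?(ltW lam0) ?(ltW N0)//.
  by rewrite -[lam^-1]powR_inv1 ?(ltW lam0)// -powRrM mulN1r; ring.
pose S (u v : n.-tuple R -> R) := [set x | (lam / 2 <= real_ext u v x)%R].
have mS u v : measurable_fun setT u -> measurable_fun setT v -> measurable (S u v).
  move=> mu mv; rewrite -[S u v]setTI (_ : S u v = real_ext u v @^-1` `[lam / 2,
    +oo[%classic).
    exact: (measurable_real_ext mu mv).
  by apply/seteqP; split => x /=; rewrite in_itv/= andbT.
have m1 := mS _ _ mre mimN; have m2 := mS _ _ mreN mimNN.
have m3 := mS _ _ mim mre; have m4 := mS _ _ mimN mreN.
have b1 := level_set_le d0 mre mimN N0 fN1 l20.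
have b2 := level_set_le d0 mreN mimNN N0 fN3 l20.
have b3 := level_set_le d0 mim mre N0 fN2 l20.
have b4 := level_set_le d0 mimN mreN N0 fN4 l20.
have sub : [set x | (lam < H x)%R] `<=` (S (re f) (imN f) `|` S (fun w => - re f w)
  (fun w => - imN f w))
   `|` (S (im f) (re f) `|` S (imN f) (fun w => - re f w)).
  move=> x /= lH.
  have e2 := real_ext_opp x mre mimN N0 fN1; have e4 := real_ext_opp x mim mre N0 fN2.
  have := lt_le_trans lH (H_le x).
  rewrite /S /= -/(hre x) -/(him x) => hlt.
  have [|h] := leP (lam / 2) `|hre x|.
    by rewrite ler_normr => /orP[h|h]; left; [left|right; rewrite /= e2].
  have : lam / 2 <= `|him x| by lra.
  by rewrite ler_normr => /orP[h'|h']; right; [left|right; rewrite /= e4].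
have mHl : measurable [set x | (lam < H x)%R].
  rewrite -[X in measurable X]setTI (_ : mkset _ = H @^-1` `]lam, +oo[%classic);
    first exact: mH.
  by apply/seteqP; split => x /=; rewrite in_itv/= andbT.
have m12 := measurableU _ _ m1 m2; have m34 := measurableU _ _ m3 m4.
have m1234 := measurableU _ _ m12 m34.
have leU (A1 A2 : set (n.-tuple R)) (x y : R) : measurable A1 -> measurable A2 ->
    (lebn A1 <= x%:E)%E -> (lebn A2 <= y%:E)%E -> (lebn (A1 `|` A2) <= (x + y)%:E)%E.
  move=> mA1 mA2 h1 h2; apply: (le_trans (measureU2 lebn mA1 mA2)).
  by rewrite EFinD; exact: leeD.
apply: (@le_trans _ _ (lebn (S (re f) (imN f) `|` S (fun w => - re f w) (fun w => -
  imN f w)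
   `|` (S (im f) (re f) `|` S (imN f) (fun w => - re f w))))).
  by apply: le_measure; rewrite ?inE.
exact: (leU _ _ _ _ m12 m34 (leU _ _ _ _ m1 m2 b1 b2) (leU _ _ _ _ m3 m4 b3 b4)).
Qed.

(** The $q$-th root of the constant of [weak_to_strong] with $N^p N^{q-p}=N^q$ taken out. Of the two
    equal powers of 2, one comes from the height $\lambda/2$ in [level], the other from the dyadic
    step. *)
Definition Lq_cst (q : R) : R :=
  (4 * level_cst d * 2 `^ crit_exp d * sup_cst `^ (q - crit_exp d) * 2 `^ crit_exp d
   / (1 - 2 `^ (- (q - crit_exp d)))) `^ q^-1.

Lemma extension_Lq q : crit_exp d < q ->
  (cLnorm lebn setT q%:E (@extension_op R n f) <= (Lq_cst q * N)%:E)%E.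
Proof.
move=> pq; have p0 : 0 < crit_exp d :> R by rewrite ltr_pwDl// divr_ge0.
have q0 := lt_trans p0 pq.
rewrite /cLnorm unlock patch_setT.
have M0 : 0 < sup_cst * N by rewrite mulr_gt0// sup_cst_gt0.
have K0 : 0 <= 4 * level_cst d * (2 * N) `^ crit_exp d.
  by apply: mulr_ge0; [apply: mulr_ge0 => //; exact: level_cst_ge0|exact: powR_ge0].
have := weak_to_strong mH H_bounded M0 K0 p0 pq level.
set D := 1 - _ => h.
have D0 : 0 < D.
  rewrite /D subr_gt0 powRN invf_lt1 ?powR_gt0//.
  have := gt0_ltr_powR (_ : 0 < q - crit_exp d) (_ : 1 \in Num.nneg) (_ : 2 \in
    Num.nneg) (_ : 1 < 2 :> R).
  by rewrite powR1; apply; rewrite ?subr_gt0 ?nnegrE// ltr1n.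
have -> : Lq_cst q * N = ((4 * level_cst d * (2 * N) `^ crit_exp d *
    (sup_cst * N) `^ (q - crit_exp d) * 2 `^ crit_exp d) / D) `^ q^-1.
  rewrite /Lq_cst -/D [(2 * N) `^ _]powRM ?(ltW N0)//.
  rewrite [(sup_cst * N) `^ _]powRM ?(ltW N0) ?(ltW sup_cst_gt0)//.
  set k := level_cst d; set a := 2 `^ _; set b := sup_cst `^ _.
  rewrite (_ : 4 * k * (a * N `^ crit_exp d) * (b * N `^ (q - crit_exp d)) * a / D =
    (4 * k * a * b * a / D) * (N `^ crit_exp d * N `^ (q - crit_exp d))); last by ring.
  rewrite -powRD; last by rewrite (gt_eqF N0) implybT.
  rewrite addrCA subrr addr0 [RHS]powRM ?powR_ge0//; last first.
    rewrite divr_ge0 ?(ltW D0)//; do 3 (apply: mulr_ge0; last exact: powR_ge0).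
    by apply: mulr_ge0 => //; exact: level_cst_ge0.
  by rewrite -[X in _ = _ * X]powRrM mulfV ?gt_eqF// powRr1// ltW.
rewrite -poweR_EFin; apply: gt0_ler_poweR; rewrite ?invr_ge0 ?(ltW q0)//.
- by rewrite in_itv/= leey andbT; apply: integral_ge0 => x _; rewrite lee_fin powR_ge0.
- by rewrite in_itv/= leey andbT lee_fin divr_ge0 ?(ltW D0)//; do 2 (apply: mulr_ge0;
  last exact: powR_ge0).
apply: le_trans h; rewrite le_eqVlt; apply/orP; left; apply/eqP.
by apply: eq_integral => x _ /=; rewrite ger0_norm//; case/andP: (H_bounded x).
Qed.

End Bounds.

End ExtensionOperator.

(** The estimates hold for every positive [N] above the $L^2$ norm; letting [N] decrease to the norm
    also covers functions of norm 0. *)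
Lemma extension_of_energy (R : realType) (d : nat) (q : \bar R) (A : R)
    (f : d.+1.-tuple R -> R[i]) : 0 <= A ->
  (forall N, 0 < N -> (energy f <= (N ^+ 2)%:E)%E ->
    (cLnorm (@lebesgue_Rn R d.+1) setT q (extension_op f) <= (A * N)%:E)%E) ->
  cLfun (@surface_measure R d.+1) (@paraboloid R d.+1) 2%:E f ->
  cLfun (@lebesgue_Rn R d.+1) setT q (extension_op f) /\
  (cLnorm (@lebesgue_Rn R d.+1) setT q (extension_op f) <=
   A%:E * cLnorm (@surface_measure R d.+1) (@paraboloid R d.+1) 2%:E f)%E.
Proof.
move=> A0 HA [mf foo].
have := energy_ge0 f; have := cLnorm2E f.
move: foo HA; rewrite (cLnorm2E f).
case: (energy f) => [rho|foo|]; last 2 first.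
- by move: foo; rewrite poweRyr ?invr_eq0// ltxx.
- by [].
move=> _ HA _ rho0; rewrite lee_fin in rho0.
rewrite poweR_EFin powR12_sqrt//.
have main : (cLnorm (@lebesgue_Rn R d.+1) setT q (extension_op f) <=
    A%:E * (Num.sqrt rho)%:E)%E.
  apply/lee_addgt0Pr => e e0.
  (* The increment of [N] is [e / (A + 1)] rather than [e / A], since [A] may be 0. *)
  have A1 : 0 < A + 1 by rewrite ltr_wpDl.
  have e1 : 0 < e / (A + 1) by rewrite divr_gt0.
  apply: le_trans (HA (Num.sqrt rho + e / (A + 1)) _ _) _.
  - by rewrite ltr_wpDl// sqrtr_ge0.
  - rewrite lee_fin -[leLHS](sqr_sqrtr rho0) lerXn2r ?nnegrE ?addr_ge0 ?sqrtr_ge0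
    ?(ltW e1)//.
    by rewrite lerDl ltW.
  - rewrite -EFinM -EFinD lee_fin mulrDr lerD2l mulrA ler_pdivrMr// mulrC.
    by rewrite ler_pM2l// lerDl.
split=> //; split; first exact: cmeasurable_extension.
by apply: le_lt_trans main _; rewrite -EFinM ltry.
Qed.

Theorem mainTheorem1 (R : realType) (n : nat) (q : \bar R) :
  (2 <= n)%N ->
  ((2 * (n%:R + 1) / (n%:R - 1))%:E < q)%E ->
  exists A : R, forall f : n.-tuple R -> R[i],
    cLfun (@surface_measure R n) (@paraboloid R n) 2%:E f ->
    cLfun (@lebesgue_Rn R n) [set: n.-tuple R] q (extension_op f) /\
    (cLnorm (@lebesgue_Rn R n) [set: n.-tuple R] q (extension_op f) <=
     A%:E * cLnorm (@surface_measure R n) (@paraboloid R n) 2%:E f)%E.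
Proof.
(* The ambient dimension is now [d.+2], so the earlier results are used with the positive base
   dimension [d.+1]. *)
case: n => [//|[//|d]] _ hq.
have critE : 2 * (d.+2%:R + 1) / (d.+2%:R - 1) = crit_exp d.+1 :> R.
  rewrite /crit_exp -(natr1 d.+1); have : d.+1%:R != 0 :> R by rewrite pnatr_eq0.
  by move: (d.+1%:R) => x x0; field; rewrite ?x0 ?andbT//; apply: contra_neq x0 =>
    <-; ring.
rewrite critE in hq.
case: q hq => [q|_|//]; last first.
  exists (sup_cst d.+1) => f [mf foo].
  apply: extension_of_energy => //; first exact: ltW (sup_cst_gt0 _).
  by move=> N N0 fN; exact: extension_sup.
rewrite lte_fin => hq.
exists (Lq_cst d.+1 q) => f [mf foo].
apply: extension_of_energy => //; first exact: powR_ge0.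
by move=> N N0 fN; exact: extension_Lq.
Qed.
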